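(* Let $2\le q<\infty$ and $2\le\sigma<\infty$. There exist constants $0<c\le C<\infty$ depending only on $q$ and $\sigma$ such that for all $m,k\in\mathbb{N}$, $n\in\mathbb{Z}_+$ with $n\le\frac{mk}{2}$ and all $p,\theta\in[1,\infty]$ satisfying one of the conditions 1) $p\ge q$, $\theta\le\sigma$, or 2) $p\le q$, $\theta\ge\sigma$, one has $$c\,\Phi(p,\theta)\le d_n(B^{m,k}_{p,\theta},\,l^{m,k}_{q,\sigma})\le C\,\Phi(p,\theta),$$ where in case 1) $$\Phi(p,\theta)=\min\left\{m^{1/q-1/p},\ m^{1/q-1/p}\bigl(n^{-\frac12}m^{\frac12}k^{\frac1\sigma}\bigr)^{\omega_{\theta,\sigma}}\right\},$$ and in case 2) $$\Phi(p,\theta)=\min\left\{k^{1/\sigma-1/\theta},\ k^{1/\sigma-1/\theta}\bigl(n^{-\frac12}m^{\frac1q}k^{\frac12}\bigr)^{\omega_{p,q}}\right\}.$$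
   Context: Convention: $1/\infty=0$. For $N\in\mathbb{N}$, $1\le s\le\infty$, $\|\cdot\|_{l_s^N}$ is the usual $\ell_s$ norm on $\mathbb{R}^N$. For $m,k\in\mathbb{N}$, $1\le p,\theta\le\infty$, $l^{m,k}_{p,\theta}$ is $\mathbb{R}^{mk}=\{(x_{i,j})_{1\le i\le m,\,1\le j\le k}\}$ with norm $\|x\|_{l^{m,k}_{p,\theta}}=\bigl\|\bigl(\|(x_{i,j})_{i=1}^m\|_{l_p^m}\bigr)_{j=1}^k\bigr\|_{l_\theta^k}$; $B^{m,k}_{p,\theta}$ is its (closed) unit ball. For a normed space $X$, $M\subset X$, $n\in\mathbb{Z}_+=\{0,1,2,\dots\}$, the Kolmogorov $n$-width is $d_n(M,X)=\inf_{L}\sup_{x\in M}\inf_{y\in L}\|x-y\|$, the infimum over linear subspaces $L\subset X$ of dimension at most $n$. For $1\le p\le q$: $\omega_{p,q}=\min\left\{\frac{1/p-1/q}{1/2-1/q},1\right\}$ if $q>2$, and $\omega_{p,q}=1$ if $q=2$; likewise $\omega_{\theta,\sigma}$ for $1\le\theta\le\sigma$. For $n=0$, terms containing $n^{-1/2}$ are read as $+\infty$ (omitted from the minimum). *)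

(* Defs.v *)
From HB Require Import structures.
From mathcomp Require Import all_boot all_order all_algebra.
From mathcomp Require Import all_classical all_reals all_analysis.

Set Implicit Arguments.
Unset Strict Implicit.
Unset Printing Implicit Defensive.

Import Order.TTheory GRing.Theory Num.Theory.
Local Open Scope classical_set_scope.
Local Open Scope ring_scope.

(* 1 / s as a real number, with 1 / +oo = 0; meant for 1 <= s <= +oo. *)
Definition recip (R : realType) (s : \bar R) : R := fine (s^-1)%E.

(* Meant for 1 <= s <= +oo; the value at -oo is junk. *)
Definition lnorm (R : realType) (s : \bar R) (N : nat) (x : 'I_N -> R) : R :=
  match s with
  | r%:E => (\sum_(i < N) `|x i| `^ r) `^ r^-1
  | +oo%E => \big[Num.max/0]_(i < N) `|x i|
  | -oo%E => 0
  end.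

(* The inner l_p^m norm runs over the first index, the outer l_theta^k norm
   over the second one. *)
Definition mixed_norm (R : realType) (m k : nat) (p theta : \bar R)
    (x : 'M[R]_(m, k)) : R :=
  lnorm theta (fun j : 'I_k => lnorm p (fun i : 'I_m => x i j)).

Definition mixed_ball (R : realType) (m k : nat) (p theta : \bar R) :
    set 'M[R]_(m, k) :=
  [set x | mixed_norm p theta x <= 1].

(* The norm is an explicit argument: the same space 'M[R]_(m, k) is used with
   several norms, none of them its canonical one. *)
Definition kolmogorov_width (R : realType) (V : vectType R) (norm : V -> R)
    (M : set V) (n : nat) : \bar R :=
  ereal_inf [set w : \bar R | exists2 L : {vspace V}, (\dim L <= n)%N &
    w = ereal_sup [set ereal_inf [set (norm (x - y))%:E | y in [set` L]]
                  | x in M]].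

(* Meant for 1 <= p <= q and 2 <= q < +oo. *)
Definition omega (R : realType) (p : \bar R) (q : R) : R :=
  if q == 2 then 1
  else Num.min ((recip p - q^-1) / (2^-1 - q^-1)) 1.

(* For n = 0 the power n^(-1/2) is read as +oo, so that the second term of the
   minimum disappears; this needs a separate case since 0 `^ (- 2^-1) = 0. *)
Definition Phi1 (R : realType) (q sigma : R) (m k n : nat)
    (p theta : \bar R) : R :=
  let A := m%:R `^ (q^-1 - recip p) in
  if n == 0%N then A
  else Num.min A
    (A * (n%:R `^ (- 2^-1) * m%:R `^ 2^-1 * k%:R `^ sigma^-1)
           `^ omega theta sigma).

Definition Phi2 (R : realType) (q sigma : R) (m k n : nat)
    (p theta : \bar R) : R :=
  let A := k%:R `^ (sigma^-1 - recip theta) in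
  if n == 0%N then A
  else Num.min A
    (A * (n%:R `^ (- 2^-1) * m%:R `^ q^-1 * k%:R `^ 2^-1)
           `^ omega p q).

(* Main.v *)
(** Upper bound: as [B_(p,theta)] is contained in [m^(1/q-1/p) B_(q,theta)] in
    case 1 and in [k^(1/sigma-1/theta) B_(p,sigma)] in case 2, one may assume
    [p = q] or [theta = sigma], respectively, and cutting a vector at a threshold
    interpolates between the trivial bound and the case where the remaining
    exponent is 2.  That case follows from the width [O(n^(-1/2) m^(1/q)
    k^(1/sigma))] of the Euclidean ball in [l_(q,sigma)], by a low M*-estimate
    in dual form: for a random n-row sign matrix, symmetrization, the
    contraction principle and Khintchine's inequality show that the kernel
    meets the polar of the unit ball of [l_(q,sigma)] in a set of small
    Euclidean radius, and Hahn-Banach turns this into an approximation from the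
    span of the rows.

    Lower bound: let [x] be a random sign matrix supported on a random a-by-b
    rectangle, [Q] the orthogonal projector onto [L], [y] in [L] and
    [z = x - y].  Then [|x|^2 - <Qx, x> = <x, z> - <Qx, z>]; the two terms on
    the right are estimated by Hoelder's inequality in terms of
    [||z||_(q,sigma)], while [<Qx, x>] has mean [ab/(mk) tr Q <= ab/2].  Rectangles
    with [a = m] or [b = k] give both cases. *)
Require Import Defs.
From mathcomp Require Import all_boot all_order all_algebra.
From mathcomp Require Import all_classical all_reals all_analysis.
From mathcomp Require Import ring lra.

Set Implicit Arguments.
Unset Strict Implicit.
Unset Printing Implicit Defensive.

Import Order.TTheory GRing.Theory Num.Theory.
Local Open Scope classical_set_scope.
Local Open Scope ring_scope.
Local Opaque powR.

(** * The norms l_s^N *)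

Fact nrm_key : unit. Proof. by []. Qed.

(* [nrm] is [lnorm], locked: otherwise unification unfolds the powers and sums
   when it compares norms with different exponents. *)
Definition nrm (R : realType) : forall (s : \bar R) N, ('I_N -> R) -> R :=
  locked_with nrm_key (@lnorm R).
Arguments nrm {R} s {N} x.

Lemma nrmE (R : realType) (s : \bar R) N (x : 'I_N -> R) : nrm s x = lnorm s x.
Proof. by rewrite /nrm locked_withE. Qed.

Section Lnorm.
Context {R : realType}.
Implicit Types (r s : R) (N : nat).

Lemma ereal_ge1_ind (P : \bar R -> Prop) (s : \bar R) :
  (forall r, 1 <= r -> P r%:E) -> P +oo%E -> (1 <= s)%E -> P s.
Proof.
by case: s => [s| |] // Pr _; rewrite lee_fin => /Pr.
Qed.

Lemma powRK r (a : R) : 0 < r -> 0 <= a -> (a `^ r) `^ r^-1 = a.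
Proof. by move=> r0 a0; rewrite -powRrM divff ?gt_eqF// powRr1. Qed.

Lemma powRVK r (a : R) : 0 < r -> 0 <= a -> (a `^ r^-1) `^ r = a.
Proof. by move=> r0 a0; rewrite -powRrM mulVf ?gt_eqF// powRr1. Qed.

Lemma lnorm_ge0 (s : \bar R) N (x : 'I_N -> R) : 0 <= nrm s x.
Proof.
case: s => [s| |]; rewrite !nrmE /lnorm; [exact: powR_ge0| |exact: lexx].
by elim/big_rec: _ => // i y _ y0; rewrite le_max y0 orbT.
Qed.

Lemma sum_powR_ge0 r N (x : 'I_N -> R) : 0 <= \sum_(i < N) `|x i| `^ r.
Proof. by apply: sumr_ge0 => i _; exact: powR_ge0. Qed.

Lemma powR_lnorm r N (x : 'I_N -> R) : 0 < r ->
  nrm r%:E x `^ r = \sum_(i < N) `|x i| `^ r.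
Proof. by move=> r0; rewrite nrmE /lnorm powRVK// sum_powR_ge0. Qed.

Lemma lnorm_leP r N (x : 'I_N -> R) (T : R) : 0 < r -> 0 <= T ->
  (nrm r%:E x <= T) = (\sum_(i < N) `|x i| `^ r <= T `^ r).
Proof.
move=> r0 T0; rewrite -powR_lnorm//; apply/idP/idP => h.
  by apply: ge0_ler_powR; rewrite ?nnegrE ?lnorm_ge0// ltW.
rewrite -(powRK r0 (lnorm_ge0 r%:E x)) -(powRK r0 T0).
by apply: ge0_ler_powR; rewrite ?nnegrE ?powR_ge0// invr_ge0 ltW.
Qed.

Lemma lnorm_mono (s : \bar R) N (x y : 'I_N -> R) : (1 <= s)%E ->
  (forall i, `|x i| <= `|y i|) -> nrm s x <= nrm s y.
Proof.
move=> s1 xy; elim/ereal_ge1_ind: s1 => [{}s s1|]; rewrite !nrmE /lnorm.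
  have s0 : 0 < s by lra.
  apply: ge0_ler_powR; rewrite ?nnegrE ?sum_powR_ge0// ?invr_ge0 ?(ltW s0)//.
  apply: ler_sum => i _; apply: ge0_ler_powR; rewrite ?nnegrE//; exact: ltW.
by apply: (big_ind2 (fun a b => a <= b)) => // a b c d ab cd; exact: le_max2.
Qed.

Lemma eq_lnorm (s : \bar R) N (x y : 'I_N -> R) :
  (forall i, `|x i| = `|y i|) -> nrm s x = nrm s y.
Proof.
move=> xy; case: s => [s| |]; rewrite !nrmE /lnorm; last by [].
  by congr (_ `^ _); apply: eq_bigr => i _; rewrite xy.
by apply: eq_bigr => i _; rewrite xy.
Qed.

Lemma lnorm_coord_le (s : \bar R) N (x : 'I_N -> R) i : (1 <= s)%E ->
  `|x i| <= nrm s x.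
Proof.
elim/ereal_ge1_ind => [{}s s1|].
  have s0 : 0 < s by lra.
  rewrite nrmE /lnorm -(powRK s0 (normr_ge0 (x i))).
  apply: ge0_ler_powR; rewrite ?nnegrE ?powR_ge0 ?sum_powR_ge0 ?invr_ge0 ?(ltW s0)//.
  rewrite (bigD1 i)//= lerDl; apply: sumr_ge0 => j _; exact: powR_ge0.
by rewrite nrmE /lnorm (bigD1 i)//= le_max lexx.
Qed.

Lemma lnormZ (s : \bar R) N (c : R) (x : 'I_N -> R) : (1 <= s)%E ->
  nrm s (fun i => c * x i) = `|c| * nrm s x.
Proof.
elim/ereal_ge1_ind => [{}s s1|]; rewrite !nrmE /lnorm.
  have s0 : 0 < s by lra.
  under eq_bigr => i _ do rewrite normrM powRM//.
  by rewrite -mulr_sumr powRM ?powR_ge0 ?sum_powR_ge0// powRK.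
under eq_bigr => i _ do rewrite normrM.
apply: (big_ind2 (fun a b => a = `|c| * b)) => //; first by rewrite mulr0.
by move=> a b a' b' -> ->; rewrite maxr_pMr.
Qed.

Lemma lnorm0 (s : \bar R) N (x : 'I_N -> R) : (1 <= s)%E ->
  (forall i, x i = 0) -> nrm s x = 0.
Proof.
move=> s1 x0; rewrite (@eq_lnorm _ _ x (fun i => 0 * x i)).
  by rewrite lnormZ// normr0 mul0r.
by move=> i; rewrite x0 mulr0.
Qed.

(** Concavity of the power, in the form of its tangent at 1; it is the source of the power mean
    inequality below. *)
Lemma powR_le_tangent (u a : R) : 0 <= u -> 0 < a -> a <= 1 ->
  u `^ a <= 1 + a * (u - 1).
Proof.
rewrite le_eqVlt => /predU1P[<-|u0] a0 a1.
  by rewrite powR0 ?gt_eqF//; lra.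
have [x <-] := expR_total u0.
rewrite -expRM mulrC.
(* With [u = expR x], both bounds come from 1 + y <= e^y. Adding them with weights [a] and [1 - a]
   cancels the terms linear in [x]. *)
have h1 : expR (a * x) * (1 + (1 - a) * x) <= expR x.
  rewrite (_ : expR x = expR (a * x) * expR ((1 - a) * x)).
    by rewrite ler_pM2l ?expR_gt0// expR_ge1Dx.
  by rewrite -expRD; congr expR; ring.
have h2 : expR (a * x) * (1 - a * x) <= 1.
  rewrite [leRHS](_ : 1 = expR (a * x) * expR (- (a * x))); last first.
    by rewrite -expRD subrr expR0.
  by rewrite ler_pM2l ?expR_gt0// expR_ge1Dx.
have h3 := ler_wpM2l (ltW a0) h1.
have a1' : 0 <= 1 - a by lra.
have h4 := ler_wpM2l a1' h2.
nra.
Qed.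

Lemma recip_EFin (s : R) : s != 0 -> recip s%:E = s^-1.
Proof. by move=> s0; rewrite /recip inver (negbTE s0). Qed.

Lemma recip_pinfty : recip (+oo : \bar R) = 0.
Proof. by rewrite /recip invey. Qed.

(** The power mean inequality. Each |x_i|^s is divided by the mean of all of them and the tangent
    bound with exponent [r / s] is applied; after summation the linear terms cancel. *)
Lemma lnorm_powmean_fin r s N (x : 'I_N -> R) : 0 < r -> r <= s ->
  nrm r%:E x <= N%:R `^ (r^-1 - s^-1) * nrm s%:E x.
Proof.
move=> r0 rs; have s0 : 0 < s by lra.
have [N0|N0] := posnP N.
  subst N; rewrite [X in X <= _]nrmE /lnorm big_ord0 powR0 ?invr_eq0 ?gt_eqF//.
  by rewrite mulr_ge0 ?powR_ge0 ?lnorm_ge0.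
have NR : 0 < N%:R :> R by rewrite ltr0n.
set T := nrm s%:E x.
have T0 : 0 <= T by exact: lnorm_ge0.
have TS : T `^ s = \sum_(i < N) `|x i| `^ s by exact: powR_lnorm.
rewrite lnorm_leP ?mulr_ge0 ?powR_ge0//.
clearbody T; move: T0; rewrite le_eqVlt => /predU1P[T0|T0].
  rewrite big1 ?powR_ge0// => i _.
  have -> : `|x i| = 0.
    apply/eqP; rewrite eq_le normr_ge0 andbT T0.
    have : `|x i| `^ s <= T `^ s.
      rewrite TS (bigD1 i)//= lerDl.
      by apply: sumr_ge0 => j _; exact: powR_ge0.
    rewrite -T0 powR0 ?gt_eqF// => h.
    have /eqP : `|x i| `^ s == 0 by rewrite eq_le h powR_ge0.
    by move/powR_eq0_eq0 => ->.
  by rewrite powR0 ?gt_eqF.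
rewrite powRM ?powR_ge0 ?(ltW T0)//.
have -> : T `^ r = (N%:R^-1 * T `^ s) `^ (r / s) * (N%:R `^ (r/s)).
  rewrite -powRM ?mulr_ge0 ?invr_ge0 ?powR_ge0 ?(ltW NR)//.
  rewrite mulrAC mulVf ?gt_eqF// mul1r -powRrM.
  by congr powR; rewrite mulrCA divff ?mulr1 ?gt_eqF.
(* [B] is the mean of the |x_i|^s, so the quotients |x_i|^s / B sum to [N]. *)
set B := _ * T `^ s.
have B0 : 0 < B by apply: mulr_gt0; [rewrite invr_gt0|exact: powR_gt0].
have step i : `|x i| `^ r <= B `^ (r/s) * (1 + r/s * (`|x i| `^ s / B - 1)).
  have -> : `|x i| `^ r = B `^ (r/s) * (`|x i| `^ s / B) `^ (r/s).
    rewrite -powRM ?divr_ge0 ?powR_ge0 ?(ltW B0)//.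
    rewrite mulrCA divff ?gt_eqF// mulr1 -powRrM.
    by congr powR; rewrite mulrCA divff ?mulr1 ?gt_eqF.
  rewrite ler_wpM2l ?powR_ge0// powR_le_tangent ?divr_gt0 ?divr_ge0 ?powR_ge0 ?(ltW B0)//.
  by rewrite ler_pdivrMr// mul1r.
apply: (le_trans (ler_sum _ (fun i _ => step i))).
rewrite -mulr_sumr big_split /= sumr_const card_ord -mulr_sumr big_split /=.
rewrite -mulr_suml -TS sumr_const card_ord.
have -> : T `^ s / B = N%:R.
  rewrite /B invfM invrK mulrCA divff ?mulr1// gt_eqF//; exact: powR_gt0.
rewrite mulNrn subrr mulr0 addr0 -powRrM.
rewrite mulrCA ler_wpM2l ?powR_ge0// -powRD; last first.
  by rewrite (gt_eqF NR) implybT.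
rewrite (_ : _ + _ = 1) ?powRr1 ?(ltW NR)//; field.
by rewrite !gt_eqF.
Qed.

Lemma lnorm_powmean r (s : \bar R) N (x : 'I_N -> R) : 0 < r -> (r%:E <= s)%E ->
  nrm r%:E x <= N%:R `^ (r^-1 - recip s) * nrm s x.
Proof.
case: s => [s| |] r0; last by [].
  rewrite lee_fin => rs.
  by rewrite recip_EFin; [exact: lnorm_powmean_fin|rewrite gt_eqF//; lra].
move=> _; rewrite recip_pinfty subr0 lnorm_leP ?mulr_ge0 ?powR_ge0 ?lnorm_ge0//.
rewrite powRM ?powR_ge0 ?lnorm_ge0// powRVK//.
rewrite mulr_natl -[X in _ *+ X]card_ord -sumr_const.
apply: ler_sum => i _; apply: ge0_ler_powR; rewrite ?nnegrE ?lnorm_ge0 ?(ltW r0)//.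
by apply: lnorm_coord_le; rewrite leey.
Qed.

(** Write |x_i|^s = |x_i|^(s-r) |x_i|^r and bound the first factor by the (s-r)-th power of the l_r
    norm. *)
Lemma lnorm_antimono r s N (x : 'I_N -> R) : 1 <= r -> r <= s ->
  nrm s%:E x <= nrm r%:E x.
Proof.
move=> r1 rs; have [r0 s0] : 0 < r /\ 0 < s by split; lra.
have [->|srN] := eqVneq s r; first by [].
have sr : 0 < s - r by rewrite lt_neqAle; rewrite subr_ge0 rs eq_sym subr_eq0 srN.
rewrite lnorm_leP ?lnorm_ge0// -(subrK r s) powRD; last first.
  by rewrite addrNK gt_eqF.
rewrite [X in _ * X]powR_lnorm// mulr_sumr; apply: ler_sum => i _.
rewrite powRD; last by rewrite addrNK gt_eqF.
rewrite ler_wpM2r ?powR_ge0//.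
apply: ge0_ler_powR; rewrite ?nnegrE ?lnorm_ge0 ?(ltW sr)//.
by apply: lnorm_coord_le; rewrite lee_fin.
Qed.

Lemma powR_convex r (a b l : R) : 1 <= r -> 0 <= a -> 0 <= b -> 0 <= l <= 1 ->
  (l * a + (1 - l) * b) `^ r <= l * a `^ r + (1 - l) * b `^ r.
Proof.
move=> r1 a0 b0 /andP[l0 l1].
have := @convex_powR R r r1 (Itv01 l0 l1) a b.
rewrite !inE /= !in_itv /= !andbT => /(_ a0 b0).
by rewrite !convRE /=.
Qed.

(** Minkowski's inequality: convexity of the r-th power at |x_i|/X and |y_i|/Y with weights X/(X+Y)
    and Y/(X+Y). Vanishing norms are treated first, because of the divisions. *)
Lemma lnormD r N (x y : 'I_N -> R) : 1 <= r ->
  nrm r%:E (fun i => x i + y i) <= nrm r%:E x + nrm r%:E y.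
Proof.
move=> r1; have r0 : 0 < r by lra.
have r1E : (1 <= r%:E)%E by rewrite lee_fin.
set X := nrm _ x; set Y := nrm _ y.
have zero (u v : 'I_N -> R) : nrm r%:E u = 0 ->
    nrm r%:E (fun i => u i + v i) <= nrm r%:E v.
  move=> u0; apply: lnorm_mono => // i.
  have := lnorm_coord_le u i r1E.
  by rewrite u0 normr_le0 => /eqP ->; rewrite add0r.
have [X0 Y0] : 0 <= X /\ 0 <= Y by split; exact: lnorm_ge0.
have zx := zero x y; have zy := zero y x; rewrite -/X -/Y in zx zy.
have XS : X `^ r = \sum_(i < N) `|x i| `^ r by exact: powR_lnorm.
have YS : Y `^ r = \sum_(i < N) `|y i| `^ r by exact: powR_lnorm.
clearbody X Y; clear zero.
move: X0; rewrite le_eqVlt => /predU1P[X0|X0].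
  by rewrite -X0 add0r; exact: zx.
move: Y0; rewrite le_eqVlt => /predU1P[Y0|Y0].
  rewrite -Y0 addr0 (@eq_lnorm _ _ _ (fun i => y i + x i)); first exact: zy.
  by move=> i; rewrite addrC.
have XY : 0 < X + Y by rewrite addr_gt0.
rewrite (lnorm_leP _ r0 (ltW XY)).
have step i : `|x i + y i| `^ r <= (X + Y) `^ r *
   (X / (X + Y) * (`|x i| / X) `^ r + (1 - X / (X + Y)) * (`|y i| / Y) `^ r).
  apply: (@le_trans _ _ ((X + Y) `^ r *
     (X / (X + Y) * (`|x i| / X) + (1 - X / (X + Y)) * (`|y i| / Y)) `^ r)).
    have l0 : 0 <= 1 - X / (X + Y) by rewrite subr_ge0 ler_pdivrMr// mul1r lerDl ltW.
    rewrite -powRM ?(ltW XY)//; last first.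
      by rewrite addr_ge0 ?mulr_ge0 ?divr_ge0 ?invr_ge0 ?normr_ge0 ?(ltW X0) ?(ltW Y0) ?(ltW XY).
    rewrite (_ : (X + Y) * _ = `|x i| + `|y i|); last first.
      by field; rewrite !gt_eqF.
    by apply: ge0_ler_powR; rewrite ?nnegrE ?addr_ge0 ?normr_ge0 ?(ltW r0)// ler_normD.
  rewrite ler_wpM2l ?powR_ge0// powR_convex ?divr_ge0 ?normr_ge0 ?(ltW X0) ?(ltW Y0) ?(ltW XY)//=.
  by rewrite ler_pdivrMr// mul1r lerDl ltW.
apply: (le_trans (ler_sum _ (fun i _ => step i))).
rewrite -mulr_sumr big_split /= -!mulr_sumr.
have unit (u : 'I_N -> R) U : U `^ r = \sum_(i < N) `|u i| `^ r -> 0 < U ->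
    \sum_(i < N) (`|u i| / U) `^ r = 1.
  move=> US U0; under eq_bigr => i _ do rewrite powRM ?invr_ge0 ?(ltW U0)//.
  rewrite -mulr_suml -US -powRM ?invr_ge0 ?(ltW U0)//.
  by rewrite divff ?gt_eqF// powR1.
by rewrite (unit x X)// (unit y Y)// !mulr1 addrC subrK mulr1.
Qed.

End Lnorm.

(** * Mixed norms *)

Definition mnrm (R : realType) m k (p t : \bar R) (x : 'M[R]_(m, k)) :=
  nrm t (fun j => nrm p (fun i => x i j)).

Lemma mnrmE (R : realType) m k (p t : \bar R) (x : 'M[R]_(m, k)) :
  mnrm p t x = mixed_norm p t x.
Proof. by rewrite /mnrm /mixed_norm nrmE; congr lnorm; apply/funext => j; rewrite nrmE. Qed.

Section Mixed.
Context {R : realType}.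
Implicit Types (r s : R) (m k : nat).

Lemma mixed_norm_ge0 m k (p t : \bar R) (x : 'M[R]_(m, k)) :
  0 <= mnrm p t x.
Proof. exact: lnorm_ge0. Qed.

Lemma mixed_normZ m k (p t : \bar R) (c : R) (x : 'M[R]_(m, k)) :
  (1 <= p)%E -> (1 <= t)%E ->
  mnrm p t (c *: x) = `|c| * mnrm p t x.
Proof.
move=> p1 t1; rewrite /mnrm -[`|c|]normr_id -lnormZ//.
apply: eq_lnorm => j; congr `|_|; rewrite -lnormZ//.
by apply: eq_lnorm => i; rewrite mxE.
Qed.

Lemma mixed_normD m k r s (x y : 'M[R]_(m, k)) : 1 <= r -> 1 <= s ->
  mnrm r%:E s%:E (x + y) <= mnrm r%:E s%:E x + mnrm r%:E s%:E y.
Proof.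
move=> r1 s1; apply: le_trans (lnormD _ _ s1).
apply: lnorm_mono => [|j]; first by rewrite lee_fin.
rewrite !ger0_norm ?addr_ge0 ?lnorm_ge0//.
apply: le_trans (lnormD _ _ r1).
by apply: lnorm_mono => [|i]; [rewrite lee_fin|rewrite mxE].
Qed.

Lemma mixed_norm0 m k (p t : \bar R) : (1 <= p)%E -> (1 <= t)%E ->
  mnrm p t (0 : 'M[R]_(m, k)) = 0.
Proof. by move=> p1 t1; rewrite -(scale0r 0) mixed_normZ// normr0 mul0r. Qed.

Lemma mixed_norm_powmean_in m k r (p t : \bar R) (x : 'M[R]_(m, k)) :
  1 <= r -> (r%:E <= p)%E -> (1 <= t)%E ->
  mnrm r%:E t x <= m%:R `^ (r^-1 - recip p) * mnrm p t x.
Proof.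
move=> r1 rp t1.
rewrite -[m%:R `^ _]ger0_norm ?powR_ge0// -lnormZ//.
apply: lnorm_mono => // j.
rewrite !ger0_norm ?mulr_ge0 ?powR_ge0 ?lnorm_ge0//.
by apply: lnorm_powmean => //; exact: lt_le_trans r1.
Qed.

Lemma mixed_norm_powmean_out m k r (p t : \bar R) (x : 'M[R]_(m, k)) :
  0 < r -> (r%:E <= t)%E ->
  mnrm p r%:E x <= k%:R `^ (r^-1 - recip t) * mnrm p t x.
Proof. by move=> r0 rt; exact: lnorm_powmean. Qed.

Lemma mixed_norm_antimono_in m k r s (t : \bar R) (x : 'M[R]_(m, k)) :
  1 <= r -> r <= s -> (1 <= t)%E ->
  mnrm s%:E t x <= mnrm r%:E t x.
Proof.
move=> r1 rs t1; apply: lnorm_mono => // j.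
by rewrite !ger0_norm ?lnorm_ge0//; exact: lnorm_antimono.
Qed.

Lemma powR2 (a : R) : 0 <= a -> a `^ 2 = a ^+ 2.
Proof. by move=> a0; rewrite -powR_mulrn. Qed.

Lemma mixed_norm22 m k (x : 'M[R]_(m, k)) :
  mnrm 2%:E 2%:E x ^+ 2 = \sum_j \sum_i x i j ^+ 2.
Proof.
rewrite -powR2 ?mixed_norm_ge0// powR_lnorm; last by lra.
apply: eq_bigr => j _; rewrite ger0_norm ?lnorm_ge0// powR_lnorm; last by lra.
by apply: eq_bigr => i _; rewrite powR2// real_normK ?num_real.
Qed.

Lemma omega_le2 r s : 2 <= s -> 1 <= r -> r <= 2 -> omega r%:E s = 1.
Proof.
move=> s2 r1 r2; rewrite /omega; case: eqP => // /eqP sN2.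
have s2' : 2 < s by rewrite lt_neqAle eq_sym sN2.
have sr : s^-1 < 2^-1 by rewrite ltf_pV2 ?posrE; lra.
have rr : 2^-1 <= r^-1 by rewrite lef_pV2 ?posrE; lra.
have r0 : 0 < r by lra.
apply: min_r; rewrite recip_EFin ?(gt_eqF r0)//.
by rewrite ler_pdivlMr; lra.
Qed.

Lemma omega_gt2 r s : 2 < r -> r <= s ->
  omega r%:E s = (r^-1 - s^-1) / (2^-1 - s^-1).
Proof.
move=> r2 rs; rewrite /omega gt_eqF; last by lra.
have sr : s^-1 < 2^-1 by rewrite ltf_pV2 ?posrE; lra.
have rr : r^-1 <= 2^-1 by rewrite lef_pV2 ?posrE; lra.
have r0 : 0 < r by lra.
rewrite recip_EFin ?(gt_eqF r0)//.
by apply: min_l; rewrite ler_pdivrMr; lra.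
Qed.

(* The threshold balances the two bounds: entries above it are controlled in
   l_2, the others in l_s. *)
Lemma threshold_split N (t : 'I_N -> R) r s u :
  2 <= s -> 1 <= r -> r <= s -> 0 < u ->
  exists b : 'I_N -> bool,
    u * nrm 2%:E (fun i => if b i then t i else 0)
      <= u `^ omega r%:E s * nrm r%:E t /\
    nrm s%:E (fun i => if b i then 0 else t i)
      <= u `^ omega r%:E s * nrm r%:E t.
Proof.
move=> s2 r1 rs u0.
have lnorm00 (v : R) : 1 <= v -> nrm v%:E (fun _ : 'I_N => 0) = 0.
  by move=> v1; rewrite lnorm0// lee_fin.
have [r2|r2] := leP r 2.
  exists (fun=> true); rewrite omega_le2// powRr1 ?(ltW u0)//; split.
    by rewrite ler_wpM2l ?(ltW u0)//; exact: lnorm_antimono.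
  by rewrite lnorm00 ?mulr_ge0 ?lnorm_ge0 ?(ltW u0)//; lra.
rewrite omega_gt2//; set w := _ / _.
have r0 : 0 < r by lra.
have s0 : 0 < s by lra.
have sr : s^-1 < 2^-1 by rewrite ltf_pV2 ?posrE; lra.
(* With the threshold u^e T, where T is the l_r norm, [e1] and [e2] say that both parts obey the
   same bound u^w T. *)
pose e := (r * (2^-1 - s^-1))^-1.
have e1 : e * (2 - r) = (w - 1) * 2.
  by rewrite /e /w; field; rewrite !gt_eqF//; nra.
have e2 : e * (s - r) = w * s.
  by rewrite /e /w; field; rewrite !gt_eqF//; nra.
set T := nrm r%:E t.
have T0 : 0 <= T by exact: lnorm_ge0.
have TS : T `^ r = \sum_(i < N) `|t i| `^ r by exact: powR_lnorm.
have Tz : T = 0 -> forall i, t i = 0.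
  move=> T00 i; apply/eqP; rewrite -normr_le0 -T00.
  by apply: lnorm_coord_le; rewrite lee_fin.
clearbody T w e; move: T0; rewrite le_eqVlt => /predU1P[T0|T0].
  exists (fun=> true); rewrite -T0 mulr0; split.
    by rewrite lnorm0 ?mulr0 ?lee_fin ?ler1n// => i; rewrite Tz.
  by rewrite lnorm00//; lra.
pose a := u `^ e * T.
have a0 : 0 < a by rewrite mulr_gt0 ?powR_gt0.
exists (fun i => a < `|t i|); split.
  suff : nrm 2%:E (fun i => if a < `|t i| then t i else 0) <= u `^ (w - 1) * T.
    move=> /(ler_wpM2l (ltW u0)) /le_trans; apply.
    rewrite mulrA -{1}[u]powRr1 ?(ltW u0)// -powRD; last by rewrite (gt_eqF u0) implybT.
    by rewrite addrC subrK.
  rewrite lnorm_leP ?mulr_ge0 ?powR_ge0 ?(ltW T0)//.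
  rewrite -(ler_pM2r (powR_gt0 (r - 2) a0)).
  have -> : (u `^ (w - 1) * T) `^ 2 * a `^ (r - 2) = T `^ r.
    rewrite /a !powRM ?powR_ge0 ?(ltW T0)// -!powRrM -e1 mulrACA.
    rewrite -!powRD ?(gt_eqF u0) ?(gt_eqF T0) ?implybT//.
    by rewrite -mulrDr (_ : 2 - r + (r - 2) = 0) ?mulr0 ?powRr0 ?mul1r; [congr powR|]; ring.
  rewrite TS mulr_suml; apply: ler_sum => i _.
  case: ifPn => ai; last by rewrite normr0 powR0 ?mul0r ?powR_ge0//; lra.
  have t0 : 0 < `|t i| by exact: lt_trans ai.
  rewrite [X in _ <= _ `^ X](_ : r = 2 + (r - 2)); last by ring.
  rewrite [leRHS]powRD ?(gt_eqF t0) ?implybT// ler_wpM2l ?powR_ge0//.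
  by apply: ge0_ler_powR; rewrite ?nnegrE ?normr_ge0 ?(ltW a0) ?(ltW ai)//; lra.
rewrite lnorm_leP ?mulr_ge0 ?powR_ge0 ?(ltW T0)//.
have -> : (u `^ w * T) `^ s = T `^ r * a `^ (s - r).
  rewrite /a !powRM ?powR_ge0 ?(ltW T0)// -!powRrM -e2 mulrCA.
  rewrite -!powRD ?(gt_eqF T0) ?implybT//.
  by congr (_ * _ `^ _); ring.
rewrite TS mulr_suml; apply: ler_sum => i _.
case: ifPn => [ai|]; first by rewrite normr0 powR0 ?gt_eqF// mulr_ge0 ?powR_ge0.
rewrite -leNgt => ai.
have := normr_ge0 (t i); rewrite le_eqVlt => /predU1P[t0|t0].
  by rewrite -t0 !powR0 ?mul0r ?gt_eqF.
rewrite [X in _ `^ X <= _](_ : s = r + (s - r)); last by ring.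
rewrite powRD ?(gt_eqF t0) ?implybT// ler_wpM2l ?powR_ge0//.
by apply: ge0_ler_powR; rewrite ?nnegrE ?normr_ge0 ?(ltW a0)//; lra.
Qed.

(** Chooses the free side of the rectangle in the lower bound. If [rho <= 1] or [r <= 2] a single
    index is enough; otherwise the side is about rho^(1/b) with b = 1/2 - 1/s, where the two terms
    of the denominator balance. *)
Lemma support_choice N r s (rho M : R) : (0 < N)%N ->
  2 <= s -> 1 <= r -> r <= s -> 0 <= rho -> rho <= N%:R `^ (2^-1 - s^-1) ->
  M <= 1 -> (0 < rho -> M <= (rho^-1) `^ omega r%:E s) ->
  exists2 n : nat, (0 < n <= N)%N &
    M / 4 <= n%:R `^ (s^-1 - r^-1) / (1 + rho * n%:R `^ (s^-1 - 2^-1)).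
Proof.
move=> N0 s2 r1 rs rho0 rhoN M1 Mrho.
have [rho1|rho1] := leP rho 1.
  exists 1%N => //; rewrite !powR1 ler_pdivlMr; last by lra.
  by nra.
have rho_gt0 : 0 < rho by lra.
have [r2|r2] := leP r 2.
  exists 1%N => //; rewrite !powR1 ler_pdivlMr; last by lra.
  have := Mrho rho_gt0; rewrite omega_le2// powRr1 ?invr_ge0// => Mr.
  have : M * rho <= 1 by rewrite -ler_pdivlMr// div1r.
  by nra.
have r0 : 0 < r by lra.
have s0 : 0 < s by lra.
have sr : s^-1 < 2^-1 by rewrite ltf_pV2 ?posrE; lra.
have srr : s^-1 <= r^-1 by rewrite lef_pV2 ?posrE.
move: Mrho; rewrite omega_gt2// => /(_ rho_gt0) Mrho.
set b := 2^-1 - s^-1 in rhoN Mrho *.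
have b0 : 0 < b by rewrite /b; lra.
have -> : s^-1 - 2^-1 = - b by rewrite /b; ring.
(* The real solution of rho x^(-b) = 1; the assumed upper bound on [rho] keeps it below [N]. *)
pose s0' := rho `^ b^-1.
have s01 : 1 <= s0'.
  rewrite -(powRr0 rho); apply: ler_powR; first by lra.
  by rewrite invr_ge0 ltW.
have s0N : s0' <= N%:R.
  rewrite /s0' -(powRK b0 (ler0n R N)).
  by apply: ge0_ler_powR; rewrite ?nnegrE ?powR_ge0 ?invr_ge0 ?(ltW b0).
have rhoE : rho = s0' `^ b by rewrite /s0' powRVK.
have /andP[t1 t2] := truncn_itv (le_trans ler01 s01).
have n0 : (0 < Num.truncn s0')%N by rewrite truncn_gt0.
exists (Num.truncn s0').
  by rewrite n0 -(ler_nat R) (le_trans t1).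
rewrite -natr1 in t2.
move: (Num.truncn s0') t1 t2 n0 => n t1 t2 n0.
have nR : 1 <= n%:R :> R by rewrite ler1n.
(* Rounding down costs at most a factor 2, since s0' < n + 1 <= 2n and b <= 1. The denominator is
   then at most 3, within the allowed factor 4. *)
have h : rho * n%:R `^ (- b) <= 2.
  rewrite rhoE powRN ler_pdivrMr ?powR_gt0//; last by lra.
  apply: (@le_trans _ _ ((2 * n%:R) `^ b)).
    apply: ge0_ler_powR; rewrite ?nnegrE ?(ltW b0)//; lra.
  rewrite powRM//.
  rewrite ler_wpM2r ?powR_ge0//.
  rewrite -[leRHS]powRr1//; apply: ler_powR; first by lra.
  by have := s0; rewrite -invr_gt0 /b; lra.
have g : (rho^-1) `^ ((r^-1 - s^-1) / b) <= n%:R `^ (s^-1 - r^-1).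
  rewrite -powR_inv1// -powRrM.
  rewrite mulN1r -mulNr opprB mulrC.
  rewrite powRrM -/s0' -opprB !powRN lef_pV2 ?posrE ?powR_gt0//; try lra.
  apply: ge0_ler_powR; rewrite ?nnegrE//; lra.
rewrite ler_pdivlMr; last first.
  by rewrite addr_gt0// mulr_gt0// powR_gt0; lra.
have := powR_ge0 n%:R (s^-1 - r^-1).
have : 0 <= rho * n%:R `^ (- b) by rewrite mulr_ge0 ?powR_ge0.
have := powR_ge0 rho^-1 ((r^-1 - s^-1) / b).
set X := n%:R `^ (s^-1 - r^-1) in g *; set Y := rho * _ in h *.
set Z := rho^-1 `^ _ in g Mrho *.
move=> Z0 Y0 X0; nra.
Qed.

End Mixed.

(** * Random signs *)

Section Average.
Context {R : realType} {T : finType}.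
Implicit Types F G : T -> R.

Definition avg F := (\sum_t F t) / #|T|%:R.

Lemma ler_avg F G : (forall t, F t <= G t) -> avg F <= avg G.
Proof. by move=> FG; rewrite ler_wpM2r ?invr_ge0// ler_sum. Qed.

Lemma avgD F G : avg (fun t => F t + G t) = avg F + avg G.
Proof. by rewrite /avg big_split mulrDl. Qed.

Lemma avgZ c F : avg (fun t => c * F t) = c * avg F.
Proof. by rewrite /avg -mulr_sumr mulrA. Qed.

Lemma avg_sum (J : finType) (F : J -> T -> R) :
  avg (fun t => \sum_j F j t) = \sum_j avg (F j).
Proof. by rewrite /avg exchange_big /= mulr_suml. Qed.

Lemma eq_avg F G : F =1 G -> avg F = avg G.
Proof. by move=> FG; rewrite /avg (eq_bigr G). Qed.

Lemma avg_reindex (h : T -> T) F : injective h -> avg (fun t => F (h t)) = avg F.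
Proof. by move=> h_inj; rewrite /avg [in RHS](reindex_inj h_inj). Qed.

Hypothesis T0 : (0 < #|T|)%N.

Lemma avg_cst c : avg (fun=> c) = c.
Proof.
by rewrite /avg sumr_const -[c *+ _]mulr_natr mulfK// pnatr_eq0 -lt0n.
Qed.

Lemma avg_le_ex F G : avg F <= avg G -> exists t, F t <= G t.
Proof.
move=> FG; apply: contrapT => /forallNP h.
suff : avg G < avg F by rewrite ltNge FG.
rewrite /avg ltr_pM2r ?invr_gt0 ?ltr0n//.
have /card_gt0P[t0 _] := T0.
apply: ltr_sum => [|t _]; last by rewrite ltNge; exact/negP.
by apply/hasP; exists t0; rewrite ?mem_index_enum.
Qed.

End Average.

Lemma exchange_avg (R : realType) (S T : finType) (F : S -> T -> R) :
  avg (fun s => avg (F s)) = avg (fun t => avg (F ^~ t)).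
Proof. by rewrite /avg -!mulr_suml exchange_big /= mulrAC. Qed.

Section Maximum.
Context {R : realType} {T : finType} (t0 : T).
Implicit Types F G : T -> R.

Definition fmax F : R := F [arg max_(t > t0) F t]%O.

Lemma le_fmax F t : F t <= fmax F.
Proof. by rewrite /fmax; case: arg_maxP => // i _; apply. Qed.

Lemma fmax_le F (M : R) : (forall t, F t <= M) -> fmax F <= M.
Proof. by move=> FM; exact: FM. Qed.

Lemma fmax_ex F : exists t, fmax F = F t.
Proof. by exists [arg max_(t > t0) F t]%O. Qed.

End Maximum.

(** * Sign vectors: second moments, exponential moments, Khintchine's inequality *)

Section Rademacher.
Context {R : realType} {I : finType}.
Notation V := {ffun I -> bool}.
Implicit Types (v : V) (y : I -> R) (s : seq V).

Lemma card_signs_gt0 : (0 < #|V|)%N.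
Proof. by apply/card_gt0P; exists [ffun=> true]. Qed.
Hint Resolve card_signs_gt0 : core.

Definition sgn v i : R := (-1) ^+ v i.

Definition sgdot v y := \sum_i sgn v i * y i.

Definition l2 y : R := Num.sqrt (\sum_i y i ^+ 2).

Lemma l2_sqr y : l2 y ^+ 2 = \sum_i y i ^+ 2.
Proof. by rewrite sqr_sqrtr// sumr_ge0// => i _; exact: sqr_ge0. Qed.

Lemma norm_sgn v i : `|sgn v i| = 1.
Proof. by rewrite normrX normrN1 expr1n. Qed.

Definition flip i v : V := [ffun j => v j (+) (j == i)].

Lemma flip_inj i : injective (flip i).
Proof.
apply: (can_inj (g := flip i)) => v; apply/ffunP => j.
by rewrite !ffunE -addbA addbb addbF.
Qed.

Lemma sgn_flip i v j : sgn (flip i v) j = (-1) ^+ (j == i) * sgn v j.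
Proof. by rewrite /sgn ffunE signr_addb mulrC. Qed.

Definition oppv v : V := [ffun j => ~~ v j].

Lemma oppv_inj : injective oppv.
Proof.
by apply: (can_inj (g := oppv)) => v; apply/ffunP => j; rewrite !ffunE negbK.
Qed.

Lemma sgdot_oppv v y : sgdot (oppv v) y = - sgdot v y.
Proof.
rewrite /sgdot -sumrN; apply: eq_bigr => i _.
by rewrite /sgn ffunE signrN mulNr.
Qed.

(** For distinct indices, flipping the i-th sign permutes the sign vectors and negates the product,
    so the mean equals its own negative. *)
Lemma avg_sgn_mul i j : avg (fun v => sgn v i * sgn v j) = (i == j)%:R.
Proof.
have [->|ij] := eqVneq i j.
  rewrite (@eq_avg _ _ _ (fun=> 1)) ?avg_cst// => v.
  by rewrite /sgn -expr2 sqrr_sign.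
set a := avg _; suff : a = - a by move=> h; clearbody a; rewrite /=; lra.
rewrite {1}/a -(avg_reindex _ (@flip_inj i)) -mulN1r -avgZ.
apply: eq_avg => v; rewrite !sgn_flip eqxx [j == i]eq_sym (negbTE ij).
by rewrite expr1 expr0 mul1r mulrA.
Qed.

Lemma avg_quadratic (Q : I -> I -> R) :
  avg (fun v => \sum_i \sum_j Q i j * (sgn v i * sgn v j)) = \sum_i Q i i.
Proof.
rewrite avg_sum; apply: eq_bigr => i _; rewrite avg_sum (bigD1 i)//=.
rewrite big1 ?addr0 => [|j ji]; rewrite avgZ avg_sgn_mul ?eqxx ?mulr1//.
by rewrite eq_sym (negbTE ji) mulr0.
Qed.

Lemma avg_sgdot_sqr y : avg (fun v => sgdot v y ^+ 2) = \sum_i y i ^+ 2.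
Proof.
rewrite -(@eq_bigr _ _ _ _ _ _ (fun i => y i * y i)) => [|i _]; last by rewrite expr2.
rewrite -(avg_quadratic (fun i j => y i * y j)); apply: eq_avg => v.
rewrite expr2 /sgdot mulr_suml; apply: eq_bigr => i _.
by rewrite mulr_sumr; apply: eq_bigr => j _; ring.
Qed.

(** From e^u <= 1/(1-u) one gets cosh t <= 1/(1-t^2) <= 1 + 2t^2 <= exp(2t^2), the middle step using
    t^2 <= 1/2. *)
Lemma cosh_le (t : R) : t ^+ 2 <= 2^-1 -> (expR t + expR (- t)) / 2 <= expR (2 * t ^+ 2).
Proof.
move=> t2; have t1 : -1 < t < 1 by apply/andP; split; nra.
have h (u : R) : u < 1 -> expR u <= (1 - u)^-1.
  move=> u1; rewrite -[u]opprK expRN opprK lef_pV2 ?posrE ?expR_gt0//; last by lra.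
  exact: expR_ge1Dx.
have h1 := h t ltac:(lra); have h2 := h (- t) ltac:(lra).
apply: le_trans (expR_ge1Dx _).
apply: (@le_trans _ _ ((1 - t ^+ 2)^-1)).
  have -> : (1 - t ^+ 2)^-1 = ((1 - t)^-1 + (1 - - t)^-1) / 2.
    by field; apply/and3P; split; apply/eqP => e; nra.
  by rewrite ler_pM2r ?invr_gt0//; lra.
by rewrite -[leLHS]div1r ler_pdivrMr; nra.
Qed.

(** Subgaussian tails of sign sums: by independence the mean factors into hyperbolic cosines, one
    per coordinate. *)
Lemma avg_expR_sgdot y : \sum_i y i ^+ 2 <= 2^-1 ->
  avg (fun v => expR (sgdot v y)) <= expR (2 * \sum_i y i ^+ 2).
Proof.
move=> y2.
have yi i : y i ^+ 2 <= 2^-1.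
  apply: le_trans y2; rewrite (bigD1 i)//= lerDl sumr_ge0// => j _.
  exact: sqr_ge0.
rewrite mulr_sumr expR_sum.
have -> : avg (fun v => expR (sgdot v y)) =
    \prod_i ((expR (y i) + expR (- y i)) / 2).
  rewrite /avg card_ffun card_bool natrX big_split /= prodr_const -exprVn.
  congr (_ * _).
  transitivity (\sum_(v : V) \prod_i expR ((-1) ^+ v i * y i)).
    by apply: eq_bigr => v _; rewrite expR_sum.
  rewrite -(bigA_distr_bigA (fun i (b : bool) => expR ((-1) ^+ b * y i))).
  apply: eq_bigr => i _; rewrite big_bool /= expr1 expr0 mulN1r mul1r.
  by rewrite addrC.
by apply: ler_prod => i _; rewrite cosh_le// divr_ge0// addr_ge0 ?expR_ge0.
Qed.

Lemma pow4_le_expR (x : R) : x ^+ 4 <= 24 * (expR x + expR (- x)).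
Proof.
have h (z : R) : 0 <= z -> z ^+ 4 <= 24 * expR z.
  move=> z0; have := @expR_ge1Dxn R z 3 z0.
  rewrite (_ : 4`! = 24%N)// => h.
  have : z ^+ 4 / 24 <= expR z by lra.
  by rewrite ler_pdivrMr; lra.
have [e1 e2] : 0 < expR x /\ 0 < expR (- x) by split; exact: expR_gt0.
have [x0|x0] := leP 0 x; first by have := h x x0; lra.
by have := h (- x) ltac:(lra); lra.
Qed.

Lemma expR_half_le2 : expR (2^-1 : R) <= 2.
Proof.
have := @expR_ge1Dx R (- 2^-1); rewrite expRN => h.
have e0 := expR_gt0 (2^-1 : R).
have : 2^-1 <= (expR (2^-1 : R))^-1 by lra.
by rewrite lef_pV2 ?posrE.
Qed.

(* |x| >= a x^2 - (a^3/4) x^4 reduces the first moment to the second and the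
   fourth one. *)
Lemma khintchine y : 256^-1 * l2 y <= avg (fun v => `|sgdot v y|).
Proof.
have [L0|L0] := eqVneq (l2 y) 0.
  rewrite L0 mulr0 -[leLHS](avg_cst card_signs_gt0).
  by apply: ler_avg => v; exact: normr_ge0.
have {}L0 : 0 < l2 y by rewrite lt_neqAle eq_sym L0 sqrtr_ge0.
(* Rescaled to squared length 1/4, so that the exponential moments of [z] and [- z] are at most
   e^(1/2) <= 2 and the fourth moment is at most 24 (2 + 2) = 96. *)
pose z i := (2 * l2 y)^-1 * y i.
have zE v : sgdot v y = 2 * l2 y * sgdot v z.
  rewrite /sgdot mulr_sumr; apply: eq_bigr => i _; rewrite /z; field.
  by rewrite gt_eqF.
have z2 : \sum_i z i ^+ 2 = 4^-1.
  rewrite /z; under eq_bigr => i _ do rewrite exprMn.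
  by rewrite -mulr_sumr -l2_sqr; field; rewrite gt_eqF.
have zN v : - sgdot v z = sgdot v (fun i => - z i).
  by rewrite /sgdot -sumrN; apply: eq_bigr => i _; rewrite mulrN.
have m4 : avg (fun v => sgdot v z ^+ 4) <= 96.
  apply: (@le_trans _ _ (24 * (avg (fun v => expR (sgdot v z)) +
      avg (fun v => expR (sgdot v (fun i => - z i)))))).
    rewrite -avgD -avgZ; apply: ler_avg => v; rewrite -zN.
    exact: pow4_le_expR.
  have e1 := @avg_expR_sgdot z ltac:(rewrite z2; lra).
  have e2 := @avg_expR_sgdot (fun i => - z i).
  have z2' : \sum_i (- z i) ^+ 2 = 4^-1.
    by rewrite -z2; apply: eq_bigr => i _; rewrite sqrrN.
  rewrite z2' z2 in e1 e2; have := e2 ltac:(lra).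
  have := expR_half_le2; rewrite (_ : 2 * 4^-1 = 2^-1) in e1 *; last by lra.
  by lra.
(* With |x| = 64 a this is a (a^3 - 4a + 4) >= 0, and the cubic equals a (a-1)^2 + 2 (a-5/4)^2 +
   7/8. The weight 1/64 is small enough for the fourth moment to leave a mean of at least 1/512. *)
have pw (x : R) : 64^-1 * x ^+ 2 + (- (64^-1 ^+ 3 / 4)) * x ^+ 4 <= `|x|.
  rewrite -[x ^+ 2]real_normK ?num_real// (_ : x ^+ 4 = `|x| ^+ 4); last first.
    by rewrite -[4%N]/(2 * 2)%N !exprM real_normK ?num_real.
  have := normr_ge0 x; set t := `|x| => t0.
  have [a0 ->] : 0 <= t / 64 /\ t = 64 * (t / 64) by split; [lra|field].
  set a := t / 64 in a0 *.
  have : 0 <= a * (a * (a - 1) ^+ 2 + 2 * (a - 5/4) ^+ 2 + 7/8).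
    have p1 := mulr_ge0 a0 (sqr_ge0 (a - 1)); have p2 := sqr_ge0 (a - 5/4).
    by apply: mulr_ge0 => //; lra.
  by lra.
rewrite (@eq_avg _ _ _ (fun v => 2 * l2 y * `|sgdot v z|)); last first.
  by move=> v; rewrite zE normrM ger0_norm// mulr_ge0// ltW.
rewrite avgZ.
have : avg (fun v => 64^-1 * sgdot v z ^+ 2 + (- (64^-1 ^+ 3 / 4)) * sgdot v z ^+ 4)
   <= avg (fun v => `|sgdot v z|) by apply: ler_avg => v; exact: pw.
rewrite avgD !avgZ avg_sgdot_sqr z2 => h.
have : 512^-1 <= avg (fun v => `|sgdot v z|) by lra.
by nra.
Qed.

End Rademacher.
#[local] Hint Resolve card_signs_gt0 : core.

(** * Means over lists of independent draws *)

Section IteratedAverage.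
Context {R : realType} {T : finType}.
Hypothesis T0 : (0 < #|T|)%N.
Implicit Types F G : seq T -> R.

(** The expectation of [F] over [n] independent uniform draws. Splitting off the head of the list
    allows the rows of a random matrix to be treated one at a time. *)
Fixpoint mavg n F : R :=
  if n is n'.+1 then avg (fun t => mavg n' (fun s => F (t :: s))) else F [::].

Lemma ler_mavg n F G : (forall s, size s = n -> F s <= G s) ->
  mavg n F <= mavg n G.
Proof.
elim: n F G => [|n IH] F G FG; first exact: FG.
by apply: ler_avg => t; apply: IH => s sn; apply: FG; rewrite /= sn.
Qed.

Lemma eq_mavg n F G : F =1 G -> mavg n F = mavg n G.
Proof.
by move=> FG; apply/eqP; rewrite eq_le !ler_mavg// => s _; rewrite FG.
Qed.

Lemma mavgD n F G : mavg n (fun s => F s + G s) = mavg n F + mavg n G.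
Proof.
elim: n F G => [//|n IH] F G /=; rewrite -avgD.
by apply: eq_avg => t; rewrite IH.
Qed.

Lemma mavgZ n c F : mavg n (fun s => c * F s) = c * mavg n F.
Proof.
elim: n F => [//|n IH] F /=; rewrite -avgZ.
by apply: eq_avg => t; rewrite IH.
Qed.

Lemma mavg_cst n c : mavg n (fun=> c) = c.
Proof.
elim: n => [//|n IH] /=.
by rewrite IH avg_cst.
Qed.

Lemma mavg_sum n (J : finType) (F : J -> seq T -> R) :
  mavg n (fun s => \sum_j F j s) = \sum_j mavg n (F j).
Proof.
elim: n F => [//|n IH] F /=; rewrite -avg_sum.
by apply: eq_avg => t; rewrite IH.
Qed.

Lemma exchange_mavg n (F : T -> seq T -> R) :
  mavg n (fun s => avg (F ^~ s)) = avg (fun t => mavg n (F t)).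
Proof.
elim: n F => [//|n IH] F /=; rewrite exchange_avg.
by apply: eq_avg => t; rewrite IH.
Qed.

Lemma mavg_prod n (g : T -> R) : mavg n (fun s => \prod_(t <- s) g t) = avg g ^+ n.
Proof.
elim: n => [|n IH] /=; first by rewrite big_nil.
rewrite exprS mulrC -avgZ; apply: eq_avg => t.
rewrite -IH mulrC -mavgZ; apply: eq_mavg => s.
by rewrite big_cons.
Qed.

Lemma mavg_le_ex n F G : mavg n F <= mavg n G ->
  exists2 s, size s = n & F s <= G s.
Proof.
elim: n F G => [|n IH] F G; first by exists [::].
move=> /(avg_le_ex T0)[t /IH[s sn st]].
by exists (t :: s); rewrite //= sn.
Qed.

End IteratedAverage.

(** * Random sign matrices: contraction, kernels and moments *)

Section SignMatrix.
Context {R : realType} {I : finType}.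
Notation V := {ffun I -> bool}.

(** One sign of the contraction principle. Let the maxima on the left be attained at t1 and t2;
    according to the sign of h(t1), test the right side with t1 in the first maximum and t2 in the
    second, or the other way round. *)
Lemma contraction_one {T : finType} (t0 : T) (A h : T -> R) :
  fmax t0 (fun t => A t + `|h t|) + fmax t0 (fun t => A t - `|h t|) <=
  fmax t0 (fun t => A t + h t) + fmax t0 (fun t => A t - h t).
Proof.
have [t1 ->] := fmax_ex t0 (fun t => A t + `|h t|).
have [t2 ->] := fmax_ex t0 (fun t => A t - `|h t|).
have p t := le_fmax t0 (fun t => A t + h t) t.
have n t := le_fmax t0 (fun t => A t - h t) t.
have := p t1; have := p t2; have := n t1; have := n t2.
have := ler_norm (h t2); have := ler_norm (- h t2); rewrite normrN.
by case: (ger0P (h t1)); lra.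
Qed.

(** Half of the increment is the mean over an independent copy, bounded below by Khintchine; the
    other half is the maximum with -2|<v,y>|. The sum of the two maxima is contracted, and the
    symmetry v -> -v merges the resulting means. *)
Lemma one_row {T : finType} (t0 : T) (A : T -> R) (y : T -> I -> R) :
  avg (fun v : V => fmax t0 (fun t => A t + (256^-1 * l2 (y t) - `|sgdot v (y t)|)))
  <= avg (fun v : V => fmax t0 (fun t => A t + 2 * sgdot v (y t))).
Proof.
pose P v := fmax t0 (fun t => A t + 2 * sgdot v (y t)).
pose P' v := fmax t0 (fun t => A t - 2 * sgdot v (y t)).
pose Q v := fmax t0 (fun t => A t + `|2 * sgdot v (y t)|).
pose Q' v := fmax t0 (fun t => A t - `|2 * sgdot v (y t)|).
have PP' : avg P' = avg P.
  rewrite -[RHS](avg_reindex _ (@oppv_inj I)); apply: eq_avg => v.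
  by rewrite /P /P'; congr fmax; apply/funext => t; rewrite sgdot_oppv mulrN.
have QP : avg Q + avg Q' <= 2 * avg P.
  rewrite mulr_natl mulr2n -{2}PP' -!avgD; apply: ler_avg => v.
  exact: contraction_one.
have step (v : V) : fmax t0 (fun t => A t + (256^-1 * l2 (y t) - `|sgdot v (y t)|))
    <= 2^-1 * avg Q + 2^-1 * Q' v.
  apply: fmax_le => t.
  have h1 : A t + 2 * (256^-1 * l2 (y t)) <= avg Q.
    apply: (@le_trans _ _ (A t + 2 * avg (fun v : V => `|sgdot v (y t)|))).
      by rewrite lerD2l ler_pM2l// khintchine.
    rewrite -[A t](avg_cst (@card_signs_gt0 I)) -avgZ -avgD.
    apply: ler_avg => w.
    have := le_fmax t0 (fun t => A t + `|2 * sgdot w (y t)|) t.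
    by rewrite -/(Q w) normrM ger0_norm.
  have := le_fmax t0 (fun t => A t - `|2 * sgdot v (y t)|) t.
  rewrite -/(Q' v) normrM ger0_norm// => h2.
  by lra.
apply: (le_trans (ler_avg step)).
rewrite avgD avg_cst// avgZ -/P; lra.
Qed.

(** Induction replaces the rows one by one; the arbitrary offset [A] absorbs the contribution of the
    other rows. *)
Lemma all_rows {T : finType} (t0 : T) n (A : T -> R) (y : T -> I -> R) :
  mavg n (fun s : seq V => fmax t0
     (fun t => A t + \sum_(v <- s) (256^-1 * l2 (y t) - `|sgdot v (y t)|)))
  <= mavg n (fun s : seq V => fmax t0 (fun t => A t + 2 * \sum_(v <- s) sgdot v (y t))).
Proof.
elim: n A => [|n IH] A.
  rewrite /=; apply: fmax_le => t; rewrite big_nil.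
  have := le_fmax t0 (fun t => A t + 2 * \sum_(v <- [::]) sgdot v (y t)) t.
  by rewrite big_nil mulr0.
pose B (v : V) t := A t + (256^-1 * l2 (y t) - `|sgdot v (y t)|).
apply: (@le_trans _ _ (avg (fun v : V => mavg n (fun s : seq V =>
    fmax t0 (fun t => B v t + 2 * \sum_(v <- s) sgdot v (y t)))))).
  apply: ler_avg => v; apply: le_trans (IH (B v)).
  apply: ler_mavg => s _; apply: fmax_le => t; rewrite big_cons addrA.
  exact: (le_fmax t0 (fun t => B v t + \sum_(w <- s) (256^-1 * l2 (y t) - `|sgdot w (y t)|))).
rewrite /= -!exchange_mavg; apply: ler_mavg => s _.
apply: le_trans (le_trans (one_row t0 (fun t => A t + 2 * \sum_(w <- s) sgdot w (y t)) y) _).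
  apply: ler_avg => v; rewrite le_eqVlt; apply/orP; left; apply/eqP.
  by congr fmax; apply/funext => t; rewrite /B; ring.
apply: ler_avg => v; rewrite le_eqVlt; apply/orP; left; apply/eqP.
by congr fmax; apply/funext => t; rewrite big_cons; ring.
Qed.

(* A low M*-estimate: y ranges over the polar body of X, which meets the kernel
   of a random sign matrix in a set of small Euclidean radius. *)
Lemma small_kernel_section (X : (I -> R) -> R) (W : R) n :
  mavg n (fun s : seq V => X (fun i => \sum_(v <- s) sgn v i)) <= W ->
  exists2 s : seq V, size s = n & forall y : I -> R,
    (forall z, \sum_i z i * y i <= X z) -> (forall v, v \in s -> sgdot v y = 0) ->
    n%:R * l2 y <= 512 * W.
Proof.
move=> XW; apply: contrapT => /forall2NP h.
(* One counterexample is chosen for each of the finitely many sign matrices, so that [all_rows]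
   applies with these matrices themselves as index set. *)
have hy (s : n.-tuple V) : exists y : I -> R,
    [/\ forall z, \sum_i z i * y i <= X z,
        forall v, v \in s -> sgdot v y = 0 & 512 * W < n%:R * l2 y].
  have [/(_ (size_tuple s))//|/existsNP[y]] := h s.
  move=> /not_implyP[yX /not_implyP[ys /negP]]; rewrite -ltNge => yW.
  by exists y.
have [y yP] := choice hy.
pose t0 : n.-tuple V := [tuple [ffun=> true] | i < n].
have := @all_rows _ t0 n (fun=> 0) y.
set F := fun s : seq V => _; set G := fun s : seq V => _ => FG.
have GW : mavg n G <= mavg n (fun _ : seq V => 2 * W).
  rewrite [leRHS]mavg_cst//; apply: le_trans (_ : mavg n (fun s : seq V =>
     2 * X (fun i => \sum_(v <- s) sgn v i)) <= _).
    apply: ler_mavg => s _; apply: fmax_le => t; rewrite add0r ler_pM2l//.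
    have [yX _ _] := yP t; apply: le_trans (yX _).
    rewrite /sgdot exchange_big /= le_eqVlt; apply/orP; left; apply/eqP.
    by apply: eq_bigr => i _; rewrite mulr_suml.
  by rewrite mavgZ ler_pM2l.
have [s sn] := mavg_le_ex (@card_signs_gt0 I) (le_trans FG GW).
have {sn}/eqP sn := sn; pose t := Tuple sn.
have [_ ys yW] := yP t.
(* The maximum for [s] is tested at the index [s]: its own rows annihilate the chosen vector,
   leaving n |y| / 256 <= 2W against the choice of y. *)
have := le_fmax t0 (fun t => 0 + \sum_(v <- s) (256^-1 * l2 (y t) - `|sgdot v (y t)|)) t.
rewrite -/(F s) => h1 h2; have := le_trans h1 h2.
rewrite (eq_big_seq (fun=> 256^-1 * l2 (y t))) => [|v vs]; last first.
  by rewrite ys// normr0 subr0.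
rewrite big_const_seq count_predT (eqP sn) iter_addr_0 add0r -mulr_natl.
by lra.
Qed.

(** Powers are dominated by exponentials, |x|^r <= (rT)^r exp(|x|/T), and exponential moments of
    independent signs multiply. *)
Lemma moment_sign_sum (r : R) n i : 0 < r -> (0 < n)%N ->
  mavg n (fun s : seq V => `|\sum_(v <- s) sgn v i| `^ r) <=
  2 * expR 1 * (r * Num.sqrt 2 * Num.sqrt n%:R) `^ r.
Proof.
move=> r0 n0; have nR : 0 < n%:R :> R by rewrite ltr0n.
(* With c = 1/T or -1/T one has 2 c^2 n = 1, so each exponential moment is at most e; also c^2 <=
   1/2, as [avg_expR_sgdot] requires. *)
pose T := Num.sqrt (2 * n%:R) : R.
have T0 : 0 < T by rewrite sqrtr_gt0 mulr_gt0.
have T2 : T ^+ 2 = 2 * n%:R by rewrite sqr_sqrtr// ltW// mulr_gt0.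
have le_exp (x : R) : `|x| `^ r <= (r * T) `^ r * (expR (T^-1 * x) + expR (T^-1 * - x)).
  apply: (@le_trans _ _ ((r * T) `^ r * expR (T^-1 * `|x|))).
    have h : `|x| <= r * T * expR (T^-1 * `|x| / r).
      have := expR_ge1Dx (T^-1 * `|x| / r) => h.
      have rT : 0 < r * T by rewrite mulr_gt0.
      have := ler_wpM2l (ltW rT) h; apply: le_trans.
      rewrite mulrDr mulr1 (_ : r * T * _ = `|x|) ?lerDr ?(ltW rT)//.
      by field; rewrite !gt_eqF.
    have : `|x| `^ r <= (r * T * expR (T^-1 * `|x| / r)) `^ r.
      apply: ge0_ler_powR; rewrite ?nnegrE ?normr_ge0 ?(ltW r0)//.
      by rewrite !mulr_ge0 ?expR_ge0 ?(ltW r0) ?(ltW T0).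
    rewrite powRM ?expR_ge0 ?mulr_ge0 ?(ltW r0) ?(ltW T0)// -expRM.
    by rewrite divfK// gt_eqF.
  rewrite ler_wpM2l ?powR_ge0//.
  have := expR_ge0 (T^-1 * x); have := expR_ge0 (T^-1 * - x).
  by have [x0|x0] := ger0P x; lra.
pose e (c : R) : I -> R := fun j => if j == i then c else 0.
have e2 c : \sum_j e c j ^+ 2 = c ^+ 2.
  rewrite (bigD1 i)//= /e eqxx big1 ?addr0// => j /negbTE ->.
  by rewrite expr0n.
have eS v c : sgdot v (e c) = c * sgn v i.
  rewrite /sgdot (bigD1 i)//= /e eqxx big1 ?addr0 ?[_ * c]mulrC// => j /negbTE ->.
  by rewrite mulr0.
have mg (c : R) : c ^+ 2 = (2 * n%:R)^-1 ->
    mavg n (fun s : seq V => expR (c * \sum_(v <- s) sgn v i)) <= expR 1.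
  move=> c2.
  rewrite (@eq_mavg _ _ _ _ (fun s : seq V => \prod_(v <- s) expR (sgdot v (e c)))); last first.
    by move=> s; rewrite mulr_sumr expR_sum; apply: eq_bigr => v _; rewrite eS.
  have c2h : c ^+ 2 <= 2^-1.
    by rewrite c2 lef_pV2 ?posrE ?mulr_gt0// ler_peMr// ler1n.
  rewrite mavg_prod; apply: (@le_trans _ _ (expR (2 * c ^+ 2) ^+ n)).
    rewrite lerXn2r ?nnegrE ?expR_ge0//.
      by rewrite -[leLHS](avg_cst (@card_signs_gt0 I)); apply: ler_avg => v; exact: expR_ge0.
    by rewrite -(e2 c); apply: avg_expR_sgdot; rewrite e2.
  rewrite -expRM_natr c2 (_ : 2 * _ * _ = 1)//; field; rewrite gt_eqF//.
apply: (@le_trans _ _ (mavg n (fun s : seq V => (r * T) `^ r *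
   (expR (T^-1 * \sum_(v <- s) sgn v i) + expR (- T^-1 * \sum_(v <- s) sgn v i))))).
  by apply: ler_mavg => s _; rewrite mulNr -mulrN.
rewrite mavgZ mavgD -(mulrA r) -sqrtrM// -/T mulrC ler_wpM2r ?powR_ge0//.
have m1 := mg T^-1; have m2 := mg (- T^-1).
rewrite sqrrN exprVn T2 in m1 m2; have := m1 erefl; have := m2 erefl; lra.
Qed.

End SignMatrix.

(** * Separation in finite dimension *)

Section HahnBanach.
Context {R : realType} {V : lmodType R}.
Implicit Types (p q : V -> R).

Definition sublinear p :=
  (forall x y, p (x + y) <= p x + p y) /\
  (forall c x, 0 < c -> p (c *: x) = c * p x).

Lemma sublinear0 p : sublinear p -> p 0 = 0.
Proof. by move=> [_ /(_ 2 0)]; rewrite scaler0 => /(_ (ltr0n _ 2)); lra. Qed.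

Lemma sublinear_oppr_ge p x : sublinear p -> - p x <= p (- x).
Proof.
by move=> hp; have := hp.1 x (- x); rewrite subrr sublinear0//; lra.
Qed.

(* The infimal convolution of p with the partial functional whose graph is C. *)
Lemma sublinear_refine p (C : set (V * R)) : sublinear p ->
  C (0, 0) ->
  (forall u v, C u -> C v -> C (u.1 + v.1, u.2 + v.2)) ->
  (forall c u, 0 < c -> C u -> C (c *: u.1, c * u.2)) ->
  (forall u, C u -> u.2 <= p u.1) ->
  exists q, [/\ sublinear q, forall x, q x <= p x,
    forall u, C u -> q (- u.1) <= - u.2 &
    forall x D, (forall u, C u -> D <= p (x + u.1) - u.2) -> D <= q x].
Proof.
move=> hp C0 CD CZ Cp.
pose S z := [set p (z + u.1) - u.2 | u in C].
have S_neq0 z : S z !=set0 by exists (p (z + 0) - 0), (0, 0).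
have qlb z u : C u -> inf (S z) <= p (z + u.1) - u.2.
  move=> Cu; apply: ge_inf; last by exists u.
  exists (- p (- z)) => _ [w Cw <-].
  by have := hp.1 (z + w.1) (- z); rewrite addrC addKr; have := Cp _ Cw; lra.
have qge x D : (forall u, C u -> D <= p (x + u.1) - u.2) -> D <= inf (S x).
  by move=> h; apply: lb_le_inf => // _ [u Cu <-]; exact: h.
have qZ c x : 0 < c -> inf (S (c *: x)) <= c * inf (S x).
  move=> c0; rewrite mulrC -ler_pdivrMr//; apply: (qge) => u Cu.
  rewrite ler_pdivrMr// mulrC mulrBr -hp.2// scalerDr.
  exact: (qlb _ (c *: u.1, c * u.2) (CZ _ _ c0 Cu)).
exists (fun z => inf (S z)); split => //.
- split => [x y|c x c0].
    rewrite -lerBlDr; apply: (qge) => u Cu.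
    rewrite lerBlDl -lerBlDr; apply: (qge) => v Cv.
    rewrite lerBlDr; apply: le_trans (qlb _ _ (CD _ _ Cu Cv)) _ => /=.
    rewrite addrACA; have := hp.1 (x + u.1) (y + v.1); lra.
  apply/eqP; rewrite eq_le qZ//=.
  have c0' : 0 < c^-1 by rewrite invr_gt0.
  have := qZ c^-1 (c *: x) c0'; rewrite scalerA mulVf ?gt_eqF// scale1r.
  by rewrite mulrC ler_pdivlMr// mulrC.
- by move=> x; have := qlb x _ C0; rewrite addr0 subr0.
- by move=> u Cu; have := qlb (- u.1) _ Cu; rewrite addNr sublinear0// add0r.
Qed.

(** Refinement by the graph of t e -> t p(e), t >= 0. The resulting bound at -e makes every
    sublinear functional below [q] odd at [e]. *)
Lemma sublinear_ray p e : sublinear p ->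
  exists q, [/\ sublinear q, forall x, q x <= p x & q (- e) <= - p e].
Proof.
move=> hp; have [||||q [hq qp qe _]] := @sublinear_refine p
    [set u | exists2 t, 0 <= t & u = (t *: e, t * p e)] hp.
- by exists 0 => //; rewrite scale0r mul0r.
- move=> _ _ [t t0 ->] [s s0 ->]; exists (t + s); first exact: addr_ge0.
  by rewrite /= scalerDl mulrDl.
- move=> c _ c0 [t t0 ->]; exists (c * t); first exact: mulr_ge0 (ltW c0) t0.
  by rewrite /= scalerA mulrA.
- move=> _ [t t0 ->] /=; move: t0; rewrite le_eqVlt => /predU1P[<-|t0].
    by rewrite scale0r mul0r sublinear0.
  by rewrite hp.2.
exists q; split => //; apply: (qe (e, p e)).
by exists 1; rewrite ?scale1r ?mul1r.
Qed.

(** Refines along one vector after another; oddness obtained at a vector survives further decrease,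
    because a sublinear q satisfies -q(e) <= q(-e). *)
Lemma sublinear_odd p (l : seq V) : sublinear p ->
  exists q, [/\ sublinear q, forall x, q x <= p x &
    forall e, e \in l -> q (- e) = - q e].
Proof.
elim: l p => [|e l IH] p hp; first by exists p.
have [q1 [hq1 q1p q1e]] := sublinear_ray e hp.
have [q [hq qq1 qo]] := IH _ hq1.
exists q; split => // [x|x]; first exact: le_trans (qq1 x) (q1p x).
rewrite inE => /predU1P[->|/qo//].
apply/eqP; rewrite eq_le sublinear_oppr_ge// andbT.
by have := qq1 (- e); have := qq1 e; have := q1p e; lra.
Qed.

End HahnBanach.

(** * Separation of a matrix from a subspace by a linear functional *)

Section Separation.
Context {R : realType} {m k : nat}.
Notation V := 'M[R]_(m, k).
Notation I := ('I_m * 'I_k)%type.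

Definition pairing (z : V) (w : I -> R) := \sum_a z a.1 a.2 * w a.

(** Three successive refinements of [p]: by the zero functional on [L], along the ray of [x] to keep
    the value at [x], and along the unit matrices, which makes the result linear. *)
Lemma sublinear_separation (p : V -> R) (L : {vspace V}) x D : sublinear p ->
  (forall y, y \in L -> D <= p (x - y)) ->
  exists w : I -> R, [/\ forall z, pairing z w <= p z,
    forall u, u \in L -> pairing u w = 0 & D <= pairing x w].
Proof.
move=> hp xD.
have [||||p0 [hp0 p0p p0L p0x]] := @sublinear_refine _ _ p
    [set u | u.1 \in L /\ u.2 = 0] hp.
- by split; rewrite ?mem0v.
- by move=> u v [uL u0] [vL v0]; split; rewrite /= ?memvD// u0 v0 addr0.
- by move=> c u c0 [uL u0]; split; rewrite /= ?memvZ// u0 mulr0.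
- move=> [u r] [/= uL ->].
  (* If [p u] were negative for some u in L, then p (x + n u) <= p x + n p u would fall below [D]
     for large n. *)
  have sub n : n%:R * p u + D <= p (x + n%:R *: u) + n%:R * p u.
    rewrite addrC lerD2r.
    have := xD (- (n%:R *: u)); rewrite opprK; apply.
    by rewrite memvN memvZ.
  rewrite leNgt; apply/negP => pu.
  have dn n : (0 < n)%N -> D <= p x + n%:R * p u.
    move=> n0; apply: le_trans (_ : p (x + n%:R *: u) <= _).
      by have := sub n; lra.
    by apply: le_trans (hp.1 _ _) _; rewrite hp.2// ltr0n.
  pose c := (p x - D) / - p u.
  have c0 : 0 <= c.
    rewrite divr_ge0 ?oppr_ge0 ?(ltW pu)// subr_ge0.
    by have := xD 0 (mem0v _); rewrite subr0.
  have /andP[_ cn] := truncn_itv c0.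
  have := dn _ (ltn0Sn (Num.truncn c)).
  move: cn; rewrite /c ltr_pdivrMr ?oppr_gt0// mulrN => h1 h2; lra.
have [p1 [hp1 p1p p1x]] := sublinear_ray x hp0.
have [q [hq qp qo]] := sublinear_odd [seq delta_mx a.1 a.2 | a : I] hp1.
(* Oddness on the unit matrices extends to all matrices, and an odd sublinear functional is
   linear. *)
have odd z : q (- z) = - q z.
  suff : q (- z) <= - q z.
    by move=> h; apply/eqP; rewrite eq_le h sublinear_oppr_ge.
  have qD a b : q (- a) <= - q a -> q (- b) <= - q b -> q (- (a + b)) <= - q (a + b).
    by rewrite opprD; have := hq.1 a b; have := hq.1 (- a) (- b); lra.
  rewrite (matrix_sum_delta z).
  have q0 : q (- 0) <= - q 0 by rewrite oppr0 sublinear0// oppr0.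
  apply: (big_ind (fun a => q (- a) <= - q a)) => // i _.
  apply: (big_ind (fun a => q (- a) <= - q a)) => // j _.
  have qd : q (- delta_mx i j) = - q (delta_mx i j).
    by apply: qo; apply/mapP; exists (i, j); rewrite ?mem_enum.
  have [c0|c0|->] := ltgtP (z i j) 0; last by rewrite scale0r.
    rewrite -scaleNr hq.2 ?oppr_gt0// -[X in - q (X *: _)]opprK scaleNr -scalerN.
    by rewrite hq.2 ?oppr_gt0// qd; lra.
  by rewrite -scalerN !hq.2// qd; lra.
have qD : {morph q : a b / a + b}.
  move=> a b; apply/eqP; rewrite eq_le hq.1/=.
  by have := hq.1 (- a) (- b); rewrite -opprD !odd; lra.
have qZ c z : q (c *: z) = c * q z.
  have [c0|c0|->] := ltgtP c 0; last by rewrite scale0r mul0r sublinear0.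
    by rewrite -[c]opprK scaleNr odd hq.2 ?oppr_gt0// !mulNr.
  by rewrite hq.2.
have qE z : pairing z (fun a => q (delta_mx a.1 a.2)) = q z.
  rewrite {2}(matrix_sum_delta z) pair_big /=.
  rewrite (big_morph q qD (sublinear0 hq)); apply: eq_bigr => a _.
  by rewrite qZ.
have qp0 z : q z <= p0 z by exact: le_trans (qp z) (p1p z).
exists (fun a => q (delta_mx a.1 a.2)); split => [z|u uL|]; rewrite qE.
- exact: le_trans (qp0 z) (p0p z).
- have h v : v \in L -> q (- v) <= 0.
    by move=> vL; apply: le_trans (qp0 _) _; have := p0L (v, 0); rewrite oppr0; apply.
  by have := h u uL; have := h (- u); rewrite memvN => /(_ uL); rewrite opprK odd; lra.
have : D <= p0 x.
  by apply: p0x => -[u r] [/= uL ->]; rewrite subr0 -[u]opprK; apply: xD; rewrite memvN.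
by have := qp (- x); rewrite odd; lra.
Qed.

End Separation.

(** * Upper bounds *)

Lemma cauchy_schwarz (R : realType) (I : finType) (a b : I -> R) :
  \sum_i a i * b i <= l2 a * l2 b.
Proof.
have z (f g : I -> R) : l2 f = 0 -> \sum_i f i * g i = 0.
  move=> f0; have := l2_sqr f; rewrite f0 expr0n /= => /esym/eqP.
  rewrite psumr_eq0 => [/allP f2|i _]; last exact: sqr_ge0.
  rewrite big1// => i _; have := f2 i (mem_index_enum _).
  by rewrite /= sqrf_eq0 => /eqP ->; rewrite mul0r.
have := sqrtr_ge0 (\sum_i a i ^+ 2); rewrite -/(l2 a) le_eqVlt => /predU1P[A0|A0].
  by rewrite z// -A0 mul0r.
have := sqrtr_ge0 (\sum_i b i ^+ 2); rewrite -/(l2 b) le_eqVlt => /predU1P[B0|B0].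
  rewrite (eq_bigr (fun i => b i * a i)) => [|i _]; last by rewrite mulrC.
  by rewrite z// -B0 mulr0.
have -> : l2 a * l2 b = \sum_i l2 a * l2 b / 2 *
    (a i ^+ 2 / l2 a ^+ 2 + b i ^+ 2 / l2 b ^+ 2).
  rewrite -mulr_sumr big_split /= -!mulr_suml -!l2_sqr.
  by field; rewrite !gt_eqF.
apply: ler_sum => i _; rewrite -subr_ge0.
have -> : l2 a * l2 b / 2 * (a i ^+ 2 / l2 a ^+ 2 + b i ^+ 2 / l2 b ^+ 2) - a i * b i
  = l2 a * l2 b / 2 * (a i / l2 a - b i / l2 b) ^+ 2.
  by field; rewrite !gt_eqF.
by rewrite mulr_ge0 ?sqr_ge0// divr_ge0// mulr_ge0// ltW.
Qed.

(** * Approximation from the span of random sign matrices *)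

Section UpperBound.
Context {R : realType}.
Variables (q sigma : R).
Hypotheses (hq : 2 <= q) (hsigma : 2 <= sigma).

Let q1 : 1 <= q. Proof. by move: hq => ?; lra. Qed.
Let s1 : 1 <= sigma. Proof. by move: hsigma => ?; lra. Qed.
Let q1E : (1 <= q%:E)%E. Proof. by rewrite lee_fin. Qed.
Let s1E : (1 <= sigma%:E)%E. Proof. by rewrite lee_fin. Qed.
Let two1E : (1 <= (2 : R)%:E)%E. Proof. by rewrite lee_fin ler1n. Qed.

Lemma powR_inv2 (a : R) : 0 <= a -> a `^ 2^-1 * a `^ 2^-1 = a.
Proof. by move=> a0; rewrite -expr2 powR12_sqrt// sqr_sqrtr. Qed.

Definition sign_mx m k (v : {ffun 'I_m * 'I_k -> bool}) : 'M[R]_(m, k) :=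
  \matrix_(i, j) sgn v (i, j).

(** Both exponents are raised to r = max(q, sigma) by power means; the r-th power of that norm is a
    sum over entries, to which [moment_sign_sum] applies. *)
Lemma mean_norm_sign_sum : exists2 C : R, 0 < C &
  forall m k n, (0 < m)%N -> (0 < k)%N -> (0 < n)%N ->
  mavg n (fun s : seq {ffun 'I_m * 'I_k -> bool} =>
     mnrm q%:E sigma%:E (\matrix_(i, j) \sum_(v <- s) sgn v (i, j)))
  <= C * (n%:R `^ 2^-1 * m%:R `^ q^-1 * k%:R `^ sigma^-1).
Proof.
pose r := Num.max q sigma.
have [qr sr] : q <= r /\ sigma <= r by rewrite !le_max !lexx orbT.
have r1 : 1 <= r by apply: le_trans qr.
have r0 : 0 < r by exact: lt_le_trans r1.
have r1E : (1 <= r%:E)%E by rewrite lee_fin.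
have e0 := expR_gt0 (1 : R).
clearbody r.
have [B BE] : {B | B = r * Num.sqrt 2} by exists (r * Num.sqrt 2).
have B0 : 0 < B by rewrite BE mulr_gt0// sqrtr_gt0.
exists ((1 + 2 * expR 1) * B); first by rewrite mulr_gt0// addr_gt0// mulr_gt0.
move=> m k n m0 k0 n0.
have [mR kR nR] : [/\ 0 < m%:R :> R, 0 < k%:R :> R & 0 < n%:R :> R] by rewrite !ltr0n.
pose M (s : seq {ffun 'I_m * 'I_k -> bool}) : 'M[R]_(m, k) :=
  \matrix_(i, j) \sum_(v <- s) sgn v (i, j).
(* Chosen so that the r-th moment of [Z] is at most 2e a^r; the bound Z <= a (1 + (Z/a)^r) then
   controls the first moment. *)
pose a := B * n%:R `^ 2^-1 * (m%:R * k%:R) `^ r^-1.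
have a0 : 0 < a by rewrite !mulr_gt0 ?powR_gt0 ?mulr_gt0.
pose Z s := mnrm r%:E r%:E (M s).
have Z0 s : 0 <= Z s by exact: mixed_norm_ge0.
have le1 s : mnrm q%:E sigma%:E (M s) <=
    m%:R `^ (q^-1 - r^-1) * k%:R `^ (sigma^-1 - r^-1) * Z s.
  apply: le_trans (mixed_norm_powmean_in (p := r%:E) _ _ _ _) _ => //.
  rewrite recip_EFin ?gt_eqF// -mulrA ler_wpM2l ?powR_ge0//.
  have := @mixed_norm_powmean_out _ m k sigma r%:E r%:E (M s).
  by rewrite recip_EFin ?gt_eqF// lee_fin; apply => //; exact: lt_le_trans s1.
have le2 s : Z s <= a * (1 + a^-1 `^ r * Z s `^ r).
  rewrite -powRM ?invr_ge0 ?(ltW a0)//.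
  have -> : Z s = a * (a^-1 * Z s) by rewrite mulrA divff ?mul1r ?gt_eqF.
  rewrite ler_pM2l// mulrA mulVf ?gt_eqF// mul1r.
  have [h|h] := leP (a^-1 * Z s) 1.
    by apply: le_trans h _; rewrite lerDl powR_ge0.
  by apply: le_trans (le1r_powR (ltW h) r1) _; rewrite lerDr.
have ZE s : Z s `^ r = \sum_j \sum_i `|\sum_(v <- s) sgn v (i, j)| `^ r.
  rewrite powR_lnorm//; apply: eq_bigr => j _.
  rewrite ger0_norm ?lnorm_ge0// powR_lnorm//; apply: eq_bigr => i _.
  by rewrite mxE.
have aE : a `^ r = m%:R * k%:R * (r * Num.sqrt 2 * Num.sqrt n%:R) `^ r.
  rewrite -BE.
  rewrite /a [LHS]powRM ?mulr_ge0 ?powR_ge0 ?(ltW B0) ?(ltW mR) ?(ltW kR)//.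
  by rewrite powRVK ?mulr_ge0 ?(ltW mR) ?(ltW kR)// powR12_sqrt ?(ltW nR)// mulrC.
have mZ : mavg n (fun s => Z s `^ r) <= 2 * expR 1 * a `^ r.
  rewrite (eq_mavg _ ZE) mavg_sum.
  have -> : 2 * expR 1 * a `^ r = \sum_(j < k) \sum_(i < m)
      2 * expR 1 * (r * Num.sqrt 2 * Num.sqrt n%:R) `^ r.
    rewrite aE; move: (_ `^ r) => W.
    by rewrite !sumr_const !card_ord -mulrnA -[RHS]mulr_natl natrM mulrCA.
  apply: ler_sum => j _; rewrite mavg_sum; apply: ler_sum => i _.
  exact: moment_sign_sum.
apply: le_trans (ler_mavg (fun s _ => le1 s)) _.
rewrite mavgZ.
have : mavg n Z <= a * (1 + 2 * expR 1).
  apply: le_trans (ler_mavg (fun s _ => le2 s)) _.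
  rewrite mavgZ ler_pM2l// mavgD mavg_cst// lerD2l mavgZ.
  have ar0 : 0 < a^-1 `^ r by rewrite powR_gt0// invr_gt0.
  apply: le_trans (ler_wpM2l (ltW ar0) mZ) _.
  rewrite mulrCA -powRM ?invr_ge0 ?(ltW a0)//.
  by rewrite mulVf ?gt_eqF// powR1 mulr1.
move=> h; apply: le_trans (ler_wpM2l _ h) _; first by rewrite mulr_ge0 ?powR_ge0.
rewrite /a powRM ?(ltW mR) ?(ltW kR)//.
have pE (b c : R) : 0 < b -> b `^ c = b `^ (c - r^-1) * b `^ r^-1.
  by move=> b0; rewrite -powRD ?subrK// (gt_eqF b0) implybT.
rewrite (pE m%:R q^-1)// (pE k%:R sigma^-1)//.
rewrite le_eqVlt; apply/orP; left; apply/eqP; ring.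
Qed.

(** Duality: a matrix far from the span of the rows is separated from it by some w in the polar body
    that annihilates the rows. Such w is short by [small_kernel_section], and Cauchy-Schwarz gives a
    contradiction. *)
Lemma l2_approximation : exists2 C : R, 0 < C &
  forall m k n, (0 < m)%N -> (0 < k)%N -> (0 < n)%N ->
  exists2 L : {vspace 'M[R]_(m, k)}, (\dim L <= n)%N &
  forall x, exists2 y, y \in L & mnrm q%:E sigma%:E (x - y) <=
    C * (n%:R `^ (- 2^-1) * m%:R `^ q^-1 * k%:R `^ sigma^-1) * mnrm 2%:E 2%:E x.
Proof.
have [C C0 hC] := mean_norm_sign_sum.
(* One more than the 512 of the kernel estimate, to make the final contradiction strict. *)
exists (513 * C); first by apply: mulr_gt0 C0; rewrite ltr0n.
move=> m k n m0 k0 n0.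
have [mR kR nR] : [/\ 0 < m%:R :> R, 0 < k%:R :> R & 0 < n%:R :> R] by rewrite !ltr0n.
pose X (f : 'I_m * 'I_k -> R) := mnrm q%:E sigma%:E (\matrix_(i, j) f (i, j)).
pose P := m%:R `^ q^-1 * k%:R `^ sigma^-1.
have P0 : 0 < P by rewrite mulr_gt0 ?powR_gt0.
have := hC m k n m0 k0 n0; rewrite -mulrA -/P => hW.
have [s sn hs] := @small_kernel_section _ _ X _ n hW.
exists <<[seq sign_mx v | v <- s]>>%VS.
  by rewrite -sn -(size_map (@sign_mx m k)) dim_span.
move=> x; have := mixed_norm_ge0 2%:E 2%:E x.
rewrite le_eqVlt => /predU1P[x0|x0].
  exists 0; first exact: mem0v.
  rewrite -x0 mulr0 subr0.
  suff -> : x = 0 by rewrite mixed_norm0.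
  apply/matrixP => i j; rewrite mxE.
  have := mixed_norm22 x; rewrite -x0 expr0n /= => /esym/eqP.
  rewrite psumr_eq0 => [/allP h|? _]; last by apply: sumr_ge0 => ? _; exact: sqr_ge0.
  have := h j (mem_index_enum _); rewrite /= psumr_eq0 => [/allP h'|? _]; last exact: sqr_ge0.
  by have := h' i (mem_index_enum _); rewrite /= sqrf_eq0 => /eqP.
apply: contrapT => /forall2NP h.
set D := 513 * C * _ * _ in h.
have hX : sublinear (mnrm q%:E sigma%:E : 'M[R]_(m, k) -> R).
  split => [a b|c a c0]; first exact: mixed_normD.
  by rewrite mixed_normZ// gtr0_norm.
have [|w [wX wL wx]] := @sublinear_separation _ _ _ _ <<[seq sign_mx v | v <- s]>>%VS x D hX.
  by move=> y yL; have [|/negP] := h y; [by []|rewrite -ltNge => /ltW].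
have nw : n%:R * l2 w <= 512 * (C * (n%:R `^ 2^-1 * P)).
  apply: hs => [z|v vs].
    apply: le_trans (wX (\matrix_(i, j) z (i, j))).
    rewrite /pairing le_eqVlt; apply/orP; left; apply/eqP.
    by apply: eq_bigr => -[i j] _; rewrite mxE.
  rewrite -(wL (sign_mx v)) ?memv_span ?map_f//.
  by apply: eq_bigr => -[i j] _; rewrite mxE.
have := cauchy_schwarz (fun a => x a.1 a.2) w.
rewrite -/(pairing x w).
have -> : l2 (fun a : 'I_m * 'I_k => x a.1 a.2) = mnrm 2%:E 2%:E x.
  apply/eqP; rewrite -(@eqrXn2 _ 2) ?sqrtr_ge0 ?mixed_norm_ge0// l2_sqr mixed_norm22.
  by rewrite exchange_big pair_big.
move=> cs; have := le_trans wx cs; apply/negP; rewrite -ltNge.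
rewrite mulrC /D ltr_pM2r// -(ltr_pM2l nR).
apply: (le_lt_trans nw).
rewrite -(mulrA _ (m%:R `^ _)) -/P -{2}(powR_inv2 (ltW nR)) powRN.
have t0 : 0 < n%:R `^ 2^-1 :> R by rewrite powR_gt0.
move: (n%:R `^ 2^-1) t0 => t t0.
rewrite (_ : t * t * _ = 513 * (C * (t * P))); last by field; rewrite gt_eqF.
have : 0 < C * (t * P) by rewrite mulr_gt0// mulr_gt0.
by lra.
Qed.

End UpperBound.

(** * Upper bounds in the two cases, by truncation *)

Section UpperCases.
Context {R : realType}.
Variables (q sigma : R).
Hypotheses (hq : 2 <= q) (hsigma : 2 <= sigma).

Let q1 : 1 <= q. Proof. by move: hq => ?; lra. Qed.
Let s1 : 1 <= sigma. Proof. by move: hsigma => ?; lra. Qed.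
Let q0 : q != 0. Proof. by rewrite gt_eqF//; move: hq => ?; lra. Qed.
Let s0 : sigma != 0. Proof. by rewrite gt_eqF//; move: hsigma => ?; lra. Qed.
Let q1E : (1 <= q%:E)%E. Proof. by rewrite lee_fin. Qed.
Let s1E : (1 <= sigma%:E)%E. Proof. by rewrite lee_fin. Qed.
Let two1 : (1 : R) <= 2. Proof. by rewrite ler1n. Qed.
Let two1E : (1 <= (2 : R)%:E)%E. Proof. by rewrite lee_fin ler1n. Qed.

Lemma approximation_split m k (x x' : 'M[R]_(m, k)) (L : {vspace 'M[R]_(m, k)})
    (E E' : R) :
  (exists2 y, y \in L & mnrm q%:E sigma%:E (x' - y) <= E) ->
  mnrm q%:E sigma%:E (x - x') <= E' ->
  exists2 y, y \in L & mnrm q%:E sigma%:E (x - y) <= E + E'.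
Proof.
move=> [y yL hy] hx; exists y => //.
rewrite (_ : x - y = (x' - y) + (x - x')); last by rewrite [RHS]addrC addrA subrK.
by apply: le_trans (mixed_normD _ _ q1 s1) _; exact: lerD.
Qed.

(** Whole columns are sorted by their l_q norms: the large ones are approximated through
    [l2_approximation], the small ones dropped. The base [u] is the Euclidean width times
    m^(1/2-1/q), the price of comparing l_2 with l_q inside a column. *)
Lemma upper_case1 : exists2 C : R, 0 < C &
  forall m k n (p : \bar R) (t : R), (0 < m)%N -> (0 < k)%N -> (0 < n)%N ->
  (q%:E <= p)%E -> 1 <= t -> t <= sigma ->
  exists2 L : {vspace 'M[R]_(m, k)}, (\dim L <= n)%N &
  forall x, mnrm p t%:E x <= 1 ->
  exists2 y, y \in L & mnrm q%:E sigma%:E (x - y) <=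
    C * (m%:R `^ (q^-1 - recip p) *
      (n%:R `^ (- 2^-1) * m%:R `^ 2^-1 * k%:R `^ sigma^-1) `^ omega t%:E sigma).
Proof.
have [C C0 hC] := l2_approximation hq hsigma.
exists (C + 1); first by rewrite addr_gt0.
move=> m k n p t m0 k0 n0 qp t1 ts.
have [L dL hL] := hC m k n m0 k0 n0.
exists L => // x x1.
have [mR kR nR] : [/\ 0 < m%:R :> R, 0 < k%:R :> R & 0 < n%:R :> R] by rewrite !ltr0n.
set A := m%:R `^ (q^-1 - recip p).
set u := n%:R `^ (- 2^-1) * _ * _.
have u0 : 0 < u by rewrite !mulr_gt0 ?powR_gt0.
have A0 : 0 <= A by exact: powR_ge0.
have t1E : (1 <= t%:E)%E by rewrite lee_fin.
have [b [b1 b2]] := threshold_split (fun j => nrm q%:E (fun i => x i j)) hsigma t1 ts u0.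
have xA : nrm t%:E (fun j => nrm q%:E (fun i => x i j)) <= A.
  have := mixed_norm_powmean_in x q1 qp t1E => /le_trans; apply.
  by rewrite -/A -[leRHS]mulr1 ler_wpM2l.
set U := u `^ _ in b1 b2 *.
have U0 : 0 <= U by exact: powR_ge0.
pose x' : 'M[R]_(m, k) := \matrix_(i, j) if b j then x i j else 0.
have cE (c : bool) j : nrm q%:E (fun i => if c then x i j else 0) =
    (if c then nrm q%:E (fun i => x i j) else 0).
  by case: c => //; rewrite lnorm0.
rewrite mulrDl mul1r; apply: (@approximation_split _ _ _ x').
  have [y yL hy] := hL x'; exists y => //; apply: le_trans hy _.
  rewrite -mulrA ler_pM2l//.
  have h22 : mnrm 2%:E 2%:E x' <= m%:R `^ (2^-1 - q^-1) * mnrm q%:E 2%:E x'.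
    rewrite -(recip_EFin q0); by apply: (mixed_norm_powmean_in _ two1 _ two1E); rewrite lee_fin.
  have hq2 : mnrm q%:E 2%:E x' = nrm 2%:E (fun j => if b j then nrm q%:E (fun i => x i j) else 0).
    apply: eq_lnorm => j; congr `|_|; rewrite -cE; apply: eq_lnorm => i.
    by rewrite mxE.
  apply: (@le_trans _ _ (u * mnrm q%:E 2%:E x')).
    have -> : u = n%:R `^ (- 2^-1) * m%:R `^ q^-1 * k%:R `^ sigma^-1 * m%:R `^ (2^-1 - q^-1).
      rewrite /u [RHS]mulrAC; congr (_ * _); rewrite -mulrA; congr (_ * _).
      by rewrite -powRD ?(gt_eqF mR) ?implybT//; congr powR; ring.
    by rewrite -[leRHS]mulrA ler_wpM2l// !mulr_ge0 ?powR_ge0.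
  rewrite hq2; apply: le_trans b1 _.
  by rewrite [leRHS]mulrC ler_wpM2l.
have -> : mnrm q%:E sigma%:E (x - x') =
   nrm sigma%:E (fun j => if b j then 0 else nrm q%:E (fun i => x i j)).
  apply: eq_lnorm => j; congr `|_|; rewrite -if_neg -cE; apply: eq_lnorm => i.
  by rewrite !mxE; case: (b j); rewrite /= ?subrr ?subr0.
by apply: le_trans b2 _; rewrite [leRHS]mulrC ler_wpM2l.
Qed.

(** Here entries are sorted inside each column, with a threshold depending on the column;
    k^(1/2-1/sigma) is the price of comparing the outer norms. *)
Lemma upper_case2 : exists2 C : R, 0 < C &
  forall m k n (p : R) (t : \bar R), (0 < m)%N -> (0 < k)%N -> (0 < n)%N ->
  1 <= p -> p <= q -> (sigma%:E <= t)%E ->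
  exists2 L : {vspace 'M[R]_(m, k)}, (\dim L <= n)%N &
  forall x, mnrm p%:E t x <= 1 ->
  exists2 y, y \in L & mnrm q%:E sigma%:E (x - y) <=
    C * (k%:R `^ (sigma^-1 - recip t) *
      (n%:R `^ (- 2^-1) * m%:R `^ q^-1 * k%:R `^ 2^-1) `^ omega p%:E q).
Proof.
have [C C0 hC] := l2_approximation hq hsigma.
exists (C + 1); first by rewrite addr_gt0.
move=> m k n p t m0 k0 n0 p1 pq st.
have [L dL hL] := hC m k n m0 k0 n0.
exists L => // x x1.
have [mR kR nR] : [/\ 0 < m%:R :> R, 0 < k%:R :> R & 0 < n%:R :> R] by rewrite !ltr0n.
set A := k%:R `^ (sigma^-1 - recip t).
set u := n%:R `^ (- 2^-1) * _ * _.
have u0 : 0 < u by rewrite !mulr_gt0 ?powR_gt0.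
have A0 : 0 <= A by exact: powR_ge0.
have p1E : (1 <= p%:E)%E by rewrite lee_fin.
have hb j := threshold_split (fun i => x i j) hq p1 pq u0.
have [b bP] := choice hb.
have xA : mnrm p%:E sigma%:E x <= A.
  have s_gt0 : 0 < sigma by exact: lt_le_trans s1.
  have := mixed_norm_powmean_out p%:E x s_gt0 st => /le_trans; apply.
  by rewrite -/A -[leRHS]mulr1 ler_wpM2l.
set U := u `^ _ in bP *.
have U0 : 0 <= U by exact: powR_ge0.
have AU : U * mnrm p%:E sigma%:E x <= A * U by rewrite mulrC ler_wpM2r.
pose x' : 'M[R]_(m, k) := \matrix_(i, j) if b j i then x i j else 0.
rewrite mulrDl mul1r; apply: (@approximation_split _ _ _ x').
  have [y yL hy] := hL x'; exists y => //; apply: le_trans hy _.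
  rewrite -mulrA ler_pM2l//.
  have h22 : mnrm 2%:E 2%:E x' <= k%:R `^ (2^-1 - sigma^-1) * mnrm 2%:E sigma%:E x'.
    by rewrite -(recip_EFin s0); apply: mixed_norm_powmean_out; rewrite ?lee_fin.
  apply: (@le_trans _ _ (u * mnrm 2%:E sigma%:E x')).
    have -> : u = n%:R `^ (- 2^-1) * m%:R `^ q^-1 * k%:R `^ sigma^-1 * k%:R `^ (2^-1 - sigma^-1).
      rewrite /u -[RHS]mulrA; congr (_ * _).
      by rewrite -powRD ?(gt_eqF kR) ?implybT//; congr powR; ring.
    by rewrite -[leRHS]mulrA ler_wpM2l// !mulr_ge0 ?powR_ge0.
  apply: le_trans AU.
  rewrite -[X in X * _ <= _]gtr0_norm// -[X in _ <= X * _]ger0_norm//.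
  rewrite -!lnormZ//; apply: lnorm_mono => // j.
  rewrite !ger0_norm ?mulr_ge0 ?lnorm_ge0 ?(ltW u0)//.
  apply: le_trans (bP j).1; rewrite le_eqVlt; apply/orP; left; apply/eqP.
  by congr (_ * _); apply: eq_lnorm => i; rewrite mxE.
apply: le_trans AU; rewrite -[X in _ <= X * _]ger0_norm//.
rewrite -lnormZ//; apply: lnorm_mono => // j.
rewrite !ger0_norm ?mulr_ge0 ?lnorm_ge0//.
apply: le_trans (bP j).2; rewrite le_eqVlt; apply/orP; left; apply/eqP.
apply: eq_lnorm => i.
by rewrite !mxE; case: (b j i); rewrite /= ?subrr ?subr0.
Qed.

End UpperCases.

(** * Lower bounds *)

Section Projector.
Context {R : realType}.

(** Gram-Schmidt: with r = v - vQ the part of the new vector orthogonal to the image so far, the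
    rank-one projector r^T r / |r|^2 is added and raises the trace by 1; for r = 0 nothing
    changes. *)
Lemma orthogonal_projector N (s : seq 'rV[R]_N) :
  exists Q : 'M[R]_N, [/\ Q^T = Q, Q *m Q = Q, \tr Q <= (size s)%:R &
    forall v, v \in s -> v *m Q = v].
Proof.
elim: s => [|v s [Q [QT QQ Qtr Qs]]].
  by exists 0; split; rewrite ?trmx0 ?mulmx0 ?mxtrace0.
pose r := v - v *m Q.
have rQ : r *m Q = 0 by rewrite mulmxBl -mulmxA QQ subrr.
have QrT : Q *m r^T = 0 by rewrite -{1}QT -trmx_mul rQ trmx0.
pose d := (r *m r^T) 0 0.
have dE : r *m r^T = d%:M by rewrite [LHS]mx11_scalar.
have d_sum : d = \sum_a r 0 a ^+ 2.
  by rewrite /d mxE; apply: eq_bigr => a _; rewrite [r^T _ _]mxE expr2.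
have [d0|d0] := eqVneq d 0.
  exists Q; split => // [|w].
    by apply: le_trans Qtr _; rewrite ler_nat; exact: leqnSn.
  rewrite inE => /predU1P[->|/Qs//].
  suff /eqP : r = 0 by rewrite subr_eq0 => /eqP <-.
  apply/rowP => a; rewrite [RHS]mxE; move/eqP: d0; rewrite d_sum.
  rewrite psumr_eq0 => [/allP h|? _]; last exact: sqr_ge0.
  by have := h a (mem_index_enum _); rewrite /= sqrf_eq0 => /eqP.
exists (Q + d^-1 *: (r^T *m r)); split.
- by rewrite linearD linearZ /= trmx_mul trmxK QT.
- have QP : Q *m (r^T *m r) = 0 by rewrite mulmxA QrT mul0mx.
  have PQ : (r^T *m r) *m Q = 0 by rewrite -mulmxA rQ mulmx0.
  have PP : (r^T *m r) *m (r^T *m r) = d *: (r^T *m r).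
    by rewrite -mulmxA (mulmxA r) dE mul_scalar_mx -scalemxAr.
  move: (r^T *m r) QP PQ PP => P QP PQ PP.
  rewrite mulmxDl !mulmxDr QQ -[Q *m _]scalemxAr QP scaler0 addr0.
  rewrite -!scalemxAl PQ scaler0 add0r -scalemxAr PP !scalerA.
  by rewrite -mulrA mulVf// mulr1.
- rewrite mxtraceD mxtraceZ mxtrace_mulC dE mxtrace_scalar mulr1n mulVf//.
  by rewrite /= -natr1 lerD2r.
- have rw w : w *m r^T = (r *m w^T) ^T by rewrite trmx_mul trmxK.
  move=> w; rewrite inE => /predU1P[->|ws].
    rewrite mulmxDr -scalemxAr mulmxA.
    have -> : v *m r^T = d%:M.
      rewrite -dE /r [in RHS]mulmxBl -/r -[v *m Q *m _]mulmxA QrT mulmx0.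
      by rewrite subr0.
    by rewrite mul_scalar_mx scalerA mulVf// scale1r addrC subrK.
  rewrite mulmxDr -scalemxAr mulmxA Qs// -{2}(Qs _ ws) -(mulmxA w) QrT mulmx0.
  by rewrite mul0mx scaler0 addr0.
Qed.

Lemma vspace_projector m k (L : {vspace 'M[R]_(m, k)}) :
  exists Q : 'M[R]_(m * k), [/\ Q^T = Q, Q *m Q = Q, \tr Q <= (\dim L)%:R &
    forall y, y \in L -> mxvec y *m Q = mxvec y].
Proof.
have [Q [QT QQ Qtr QL]] := orthogonal_projector [seq mxvec v | v <- vbasis L].
exists Q; split => //; first by move: Qtr; rewrite size_map size_tuple.
move=> y /coord_vbasis ->; rewrite linear_sum mulmx_suml; apply: eq_bigr => i _.
rewrite linearZ /= -scalemxAl QL// map_f// mem_nth// size_tuple.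
exact: ltn_ord.
Qed.

End Projector.

(** * Hoelder estimates on rectangles and norms of sign patterns *)

Section LowerBound.
Context {R : realType}.

Lemma avg_le_sqrt (T : finType) (f : T -> R) : (0 < #|T|)%N ->
  avg f <= Num.sqrt (avg (fun t => f t ^+ 2)).
Proof.
move=> T0; have TR : 0 < #|T|%:R :> R by rewrite ltr0n.
have := cauchy_schwarz f (fun=> 1).
rewrite (eq_bigr f) => [|i _]; last by rewrite mulr1.
rewrite {2}/l2 sumr_const expr1n => h.
rewrite /avg ler_pdivrMr//; apply: le_trans h _.
rewrite sqrtrM ?sumr_ge0// => [|i _]; last exact: sqr_ge0.
rewrite -/(l2 f) -mulrA ler_wpM2l ?sqrtr_ge0//.
rewrite -[X in _ * X]sqr_sqrtr ?(ltW TR)// sqrtrV ?(ltW TR)//.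
by rewrite expr2 mulKf// gt_eqF// sqrtr_gt0.
Qed.

Lemma sum_lnorm_subset N (A : {set 'I_N}) q (z : 'I_N -> R) : 1 <= q ->
  \sum_(i in A) `|z i| <= #|A|%:R `^ (1 - q^-1) * nrm q%:E z.
Proof.
move=> q1; have q0 : 0 < q by lra.
pose z' (l : 'I_#|A|) := z (enum_val l).
have h := @lnorm_powmean_fin R 1 q _ z' ltr01 q1.
apply: (@le_trans _ _ (nrm 1%:E z')).
  rewrite -[leRHS]powRr1 ?lnorm_ge0// powR_lnorm//.
  rewrite (big_enum_val (fun i => `|z i|)) /= le_eqVlt; apply/orP; left.
  by apply/eqP; apply: eq_bigr => i _; rewrite powRr1.
apply: le_trans h _; rewrite invr1 ler_wpM2l ?powR_ge0//.
rewrite lnorm_leP ?lnorm_ge0// powR_lnorm//.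
rewrite -(big_enum_val (fun i => `|z i| `^ q)) /= [leRHS](bigID (mem A)) /= lerDl.
by apply: sumr_ge0 => i _; exact: powR_ge0.
Qed.

Lemma sum_mixed_norm_rectangle m k (A : {set 'I_m}) (B : {set 'I_k}) q s
    (z : 'M[R]_(m, k)) : 1 <= q -> 1 <= s ->
  \sum_(j in B) \sum_(i in A) `|z i j| <=
  #|A|%:R `^ (1 - q^-1) * #|B|%:R `^ (1 - s^-1) * mnrm q%:E s%:E z.
Proof.
move=> q1 s1; apply: (@le_trans _ _ (\sum_(j in B) #|A|%:R `^ (1 - q^-1) *
    `|nrm q%:E (fun i => z i j)|)).
  apply: ler_sum => j _; rewrite ger0_norm ?lnorm_ge0//.
  exact: sum_lnorm_subset.
rewrite -mulr_sumr -mulrA ler_wpM2l ?powR_ge0//.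
exact: sum_lnorm_subset.
Qed.

Lemma lnorm_indicator_le N (A : {set 'I_N}) (s : \bar R) : (1 <= s)%E ->
  (0 < #|A|)%N -> nrm s (fun i => (i \in A)%:R) <= #|A|%:R `^ recip s.
Proof.
move=> s1 A0; elim/(@ereal_ge1_ind R): s1 => [{}s s1|].
  have s0 : 0 < s by lra.
  rewrite recip_EFin ?gt_eqF// lnorm_leP ?powR_ge0// powRVK ?ler0n//.
  rewrite -sum1_card natr_sum [leRHS]big_mkcond /=; apply: ler_sum => i _.
  by case: (i \in A); rewrite ?normr1 ?powR1// normr0 powR0 ?gt_eqF.
rewrite recip_pinfty powRr0 nrmE /lnorm.
elim/big_ind: _ => // [x y x1 y1|i _]; first by rewrite ge_max x1.
by case: (_ \in _); rewrite ?normr1 ?normr0.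
Qed.

Definition is_pattern m k (A : {set 'I_m}) (B : {set 'I_k}) (x : 'M[R]_(m, k)) :=
  forall i j, `|x i j| = ((i \in A) && (j \in B))%:R.

Lemma pattern_norm_le m k (A : {set 'I_m}) (B : {set 'I_k}) (x : 'M[R]_(m, k))
    (p t : \bar R) : (1 <= p)%E -> (1 <= t)%E -> (0 < #|A|)%N -> (0 < #|B|)%N ->
  is_pattern A B x -> mnrm p t x <= #|A|%:R `^ recip p * #|B|%:R `^ recip t.
Proof.
move=> p1 t1 A0 B0 xAB.
apply: (@le_trans _ _ (nrm t (fun j => #|A|%:R `^ recip p * (j \in B)%:R))).
  apply: lnorm_mono => // j.
  rewrite !ger0_norm ?mulr_ge0 ?powR_ge0 ?lnorm_ge0//.
  case: (boolP (j \in B)) => jB.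
    rewrite mulr1; apply: le_trans (lnorm_indicator_le p1 A0).
    by apply: lnorm_mono => // i; rewrite xAB jB andbT ger0_norm.
  rewrite mulr0 lnorm0// => i; apply/eqP; rewrite -normr_eq0 xAB (negbTE jB).
  by rewrite andbF.
rewrite lnormZ// ger0_norm ?powR_ge0// ler_wpM2l ?powR_ge0//.
exact: lnorm_indicator_le.
Qed.

End LowerBound.

(** * Random rectangles of signs and their projections *)

Section Rectangle.
Context {R : realType}.

Lemma sum_mxvec m k (f : 'I_(m * k) -> R) :
  \sum_a f a = \sum_i \sum_j f (mxvec_index i j).
Proof.
rewrite pair_big (reindex _ (curry_mxvec_bij _ _)) /=.
by apply: eq_bigr => -[].
Qed.

(** A cyclic translate of an interval of length [a], addition being modulo [N.+1]. For uniform [t]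
    every index is covered equally often, which is all the randomness that the rectangle needs. *)
Definition shift N a (t : 'I_N.+1) : {set 'I_N.+1} :=
  [set i | ((i + t)%R < a)%N].

Lemma card_lt_ord N a : (a <= N)%N -> #|[set i : 'I_N | (i < a)%N]%SET| = a.
Proof.
move=> aN; rewrite -sum1_card (eq_bigl (fun i : 'I_N => (i < a)%N)) => [|i].
  by rewrite -(big_ord_widen _ (fun=> 1%N))// sum1_card card_ord.
by rewrite inE.
Qed.

Lemma card_shift N a (t : 'I_N.+1) : (a <= N.+1)%N -> #|shift a t| = a.
Proof.
move=> aN; rewrite -[RHS](card_lt_ord aN) -(card_preimset _ (@addIr _ t)).
by apply: eq_card => i; rewrite !inE.
Qed.

Lemma card_shift_pre N a (i : 'I_N.+1) : (a <= N.+1)%N ->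
  \sum_t (i \in shift a t)%:R = a%:R :> R.
Proof.
move=> aN; rewrite -natr_sum; congr _%:R.
rewrite -[RHS](card_shift i aN) -sum1_card [RHS]big_mkcond.
by apply: eq_bigr => t _; rewrite !inE addrC; case: ifP.
Qed.

Section Bound.
Variables (q s : R) (m k n : nat) (Q : 'M[R]_(m.+1 * k.+1)) (D : R).
Local Notation N := (m.+1 * k.+1)%N.
Local Notation V := {ffun 'I_N -> bool}.
Local Notation IT := ('I_m.+1 * 'I_k.+1)%type.
Variables (a b : nat).

Definition rect_mx (t : IT) : 'M[R]_(m.+1, k.+1) :=
  \matrix_(i, j) ((i \in shift a t.1) && (j \in shift b t.2))%:R.

Definition sign_rect (v : V) (t : IT) : 'M[R]_(m.+1, k.+1) :=
  \matrix_(i, j) (sgn v (mxvec_index i j) * rect_mx t i j).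

Definition rect_energy (v : V) (t : IT) : R :=
  (mxvec (sign_rect v t) *m Q *m (mxvec (sign_rect v t))^T) 0 0.

Lemma sign_rect_pattern v t :
  is_pattern (shift a t.1) (shift b t.2) (sign_rect v t).
Proof.
by move=> i j; rewrite !mxE normrM norm_sgn mul1r ger0_norm.
Qed.

Lemma mxvec_sign_rect v t l :
  mxvec (sign_rect v t) 0 l = sgn v l * mxvec (rect_mx t) 0 l.
Proof. by case/mxvec_indexP: l => i j; rewrite !mxvecE mxE. Qed.

Hypotheses (aN : (a <= m.+1)%N) (bN : (b <= k.+1)%N).

Lemma sign_rect_sqr v t :
  (mxvec (sign_rect v t) *m (mxvec (sign_rect v t))^T) 0 0 = a%:R * b%:R.
Proof.
rewrite mxE sum_mxvec.
transitivity (\sum_i \sum_j (i \in shift a t.1)%:R * (j \in shift b t.2)%:R : R).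
  apply: eq_bigr => i _; apply: eq_bigr => j _.
  rewrite [_^T _ _]mxE -expr2 -real_normK ?num_real// mxvecE sign_rect_pattern.
  by rewrite -mulnb natrM exprMn; case: (_ \in _); case: (_ \in _); rewrite ?expr1n ?expr0n.
under eq_bigr => i _ do rewrite -mulr_sumr.
rewrite -mulr_suml -!natr_sum; congr (_%:R * _%:R).
  by rewrite -[RHS](card_shift t.1 aN) -sum1_card [RHS]big_mkcond; apply: eq_bigr => i _; case: ifP.
by rewrite -[RHS](card_shift t.2 bN) -sum1_card [RHS]big_mkcond; apply: eq_bigr => i _; case: ifP.
Qed.

(** The signs leave only the diagonal of [Q], and the shifts cover each diagonal position with
    frequency ab/(mk). *)
Lemma avg_rect_energy :
  avg (fun t : IT => avg (fun v : V => rect_energy v t)) =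
  a%:R * b%:R / (m.+1%:R * k.+1%:R) * \tr Q.
Proof.
pose c t l := mxvec (rect_mx t) 0 l.
have E t : avg (fun v : V => rect_energy v t) = \sum_l Q l l * c t l ^+ 2.
  transitivity (\sum_l Q l l * c t l * c t l); last first.
    by apply: eq_bigr => l _; rewrite -mulrA -expr2.
  rewrite -(avg_quadratic (fun l l' => Q l l' * c t l * c t l')).
  apply: eq_avg => v; rewrite /rect_energy mxE exchange_big /=.
  apply: eq_bigr => l' _; rewrite mxE mulr_suml; apply: eq_bigr => l _.
  by rewrite [_^T _ _]mxE !mxvec_sign_rect -!/(c t _); ring.
rewrite (eq_avg E) avg_sum /mxtrace mulr_sumr; apply: eq_bigr => l _.
rewrite avgZ mulrC; congr (_ * _).
rewrite /avg card_prod !card_ord natrM; congr (_ / _).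
case/mxvec_indexP: l => i j; rewrite /c.
rewrite -(card_shift_pre i aN) -(card_shift_pre j bN) mulr_suml.
under [RHS]eq_bigr => t _ do rewrite mulr_sumr.
rewrite pair_big /=; apply: eq_bigr => t _; rewrite mxvecE mxE.
by rewrite -mulnb natrM exprMn; case: (_ \in _); case: (_ \in _); rewrite ?expr1n ?expr0n.
Qed.

Hypotheses (hq : 2 <= q) (hs : 2 <= s) (QT : Q^T = Q) (QQ : Q *m Q = Q).

Lemma rect_energy_sqr v t :
  rect_energy v t = \sum_l (mxvec (sign_rect v t) *m Q) 0 l ^+ 2.
Proof.
rewrite /rect_energy -{1}QQ mulmxA -mulmxA -{2}QT -trmx_mul mxE.
by apply: eq_bigr => l _; rewrite [_^T _ _]mxE expr2.
Qed.

Lemma sign_rect_bound v t y : mxvec y *m Q = mxvec y ->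
  mnrm q%:E s%:E (sign_rect v t - y) <= D ->
  a%:R * b%:R - rect_energy v t <=
    D * (a%:R `^ (1 - q^-1) * b%:R `^ (1 - s^-1)) +
    D * (m.+1%:R `^ (2^-1 - q^-1) * k.+1%:R `^ (2^-1 - s^-1)) *
      Num.sqrt (rect_energy v t).
Proof.
move=> yQ zD; set x := sign_rect v t in zD *; set z := x - y in zD.
have [q1 s1] : 1 <= q /\ 1 <= s by split; [move: hq|move: hs] => ?; lra.
have [q0 s0] : 0 < q /\ 0 < s by split; lra.
(* Since y is fixed by the symmetric [Q], <Qx, y> = <x, y>, so replacing x by z = x - y leaves the
   difference unchanged. *)
have -> : a%:R * b%:R - rect_energy v t =
   (mxvec x *m (mxvec z)^T) 0 0 - (mxvec x *m Q *m (mxvec z)^T) 0 0.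
  rewrite -(sign_rect_sqr v t) /rect_energy -/x /z linearB /= linearB /= !mulmxBr.
  have -> : mxvec x *m Q *m (mxvec y)^T = mxvec x *m (mxvec y)^T.
    by rewrite -mulmxA -{1}QT -trmx_mul yQ.
  by rewrite !mxE; ring.
apply: lerD.
  apply: (@le_trans _ _ (\sum_(j in shift b t.2) \sum_(i in shift a t.1) `|z i j|)).
    rewrite mxE sum_mxvec exchange_big /= [leRHS]big_mkcond.
    apply: ler_sum => j _; case: ifPn => jB.
      rewrite [leRHS]big_mkcond; apply: ler_sum => i _.
      rewrite [_^T _ _]mxE !mxvecE; apply: le_trans (ler_norm _) _.
      rewrite normrM sign_rect_pattern jB andbT.
      by case: ifP; rewrite ?mul1r ?mul0r.
    rewrite big1// => i _; rewrite [_^T _ _]mxE !mxvecE.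
    have := sign_rect_pattern v t i j; rewrite (negbTE jB) andbF => /eqP.
    by rewrite normr_eq0 -/x => /eqP ->; rewrite mul0r.
  apply: le_trans (sum_mixed_norm_rectangle _ _ _ q1 s1) _.
  by rewrite !card_shift// mulrC ler_wpM2r// mulr_ge0 ?powR_ge0.
rewrite mxE -sumrN.
under eq_bigr => l _ do rewrite -mulNr [_^T _ _]mxE.
apply: le_trans (cauchy_schwarz _ _) _.
have -> : l2 (fun l => - (mxvec x *m Q) 0 l) = Num.sqrt (rect_energy v t).
  by rewrite rect_energy_sqr /l2; congr Num.sqrt; apply: eq_bigr => l _; rewrite sqrrN.
rewrite mulrC ler_wpM2r ?sqrtr_ge0//.
have -> : l2 (fun l => mxvec z 0 l) = mnrm 2%:E 2%:E z.
  apply/eqP; rewrite -(@eqrXn2 _ 2) ?sqrtr_ge0 ?mixed_norm_ge0// l2_sqr mixed_norm22.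
  rewrite sum_mxvec exchange_big; apply/eqP; apply: eq_bigr => j _.
  by apply: eq_bigr => i _; rewrite mxvecE.
have h1 : mnrm 2%:E 2%:E z <= m.+1%:R `^ (2^-1 - q^-1) * mnrm q%:E 2%:E z.
  rewrite -[q^-1]recip_EFin ?gt_eqF//.
  by apply: mixed_norm_powmean_in; rewrite ?lee_fin// ler1n.
have h2 : mnrm q%:E 2%:E z <= k.+1%:R `^ (2^-1 - s^-1) * mnrm q%:E s%:E z.
  rewrite -[s^-1]recip_EFin ?gt_eqF//.
  by apply: mixed_norm_powmean_out; rewrite ?lee_fin.
apply: le_trans h1 _; rewrite [leRHS]mulrC -mulrA ler_wpM2l ?powR_ge0//.
by apply: le_trans h2 _; rewrite ler_wpM2l ?powR_ge0.
Qed.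

End Bound.
End Rectangle.

(** * The lower bound obtained from a rectangle of given sides *)

Section LowerCases.
Context {R : realType}.
Variables (q sigma : R).
Hypotheses (hq : 2 <= q) (hsigma : 2 <= sigma).

(** The bound of [sign_rect_bound] is averaged over signs and positions. The mean energy is at most
    ab/2 because tr Q <= n <= mk/2, and Jensen's inequality moves the mean inside the square
    root. *)
Lemma rectangle_lower m k n a b (L : {vspace 'M[R]_(m, k)}) (D : R) :
  (0 < a <= m)%N -> (0 < b <= k)%N -> (2 * n <= m * k)%N -> (\dim L <= n)%N ->
  0 <= D ->
  (forall (A : {set 'I_m}) (B : {set 'I_k}) x, #|A| = a -> #|B| = b ->
     is_pattern A B x -> exists2 y, y \in L & mnrm q%:E sigma%:E (x - y) <= D) ->
  a%:R * b%:R / 2 <= D * (a%:R `^ (1 - q^-1) * b%:R `^ (1 - sigma^-1)) +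
    D * (m%:R `^ (2^-1 - q^-1) * k%:R `^ (2^-1 - sigma^-1)) *
      Num.sqrt (a%:R * b%:R / (m%:R * k%:R) * n%:R).
Proof.
case: m L => [|m] L; first by case: a.
case: k L => [|k] L; first by case: b; rewrite ?andbF.
move=> /andP[a0 am] /andP[b0 bk] nmk dL D0 hD.
have [Q [QT QQ Qtr QL]] := vspace_projector L.
set al := a%:R `^ _ * _; set be := m.+1%:R `^ _ * _.
set rho := a%:R * b%:R / (_ * _).
have rho0 : 0 <= rho by rewrite divr_ge0 ?mulr_ge0.
have Qn : \tr Q <= n%:R by apply: le_trans Qtr _; rewrite ler_nat.
have h v t : a%:R * b%:R - rect_energy Q a b v t <=
    D * al + D * be * Num.sqrt (rect_energy Q a b v t).
  have [] := hD _ _ (sign_rect a b v t) (card_shift t.1 am) (card_shift t.2 bk).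
    exact: sign_rect_pattern.
  by move=> y yL yD; apply: (sign_rect_bound am bk hq hsigma QT QQ (QL y yL) yD).
have cV := @card_signs_gt0 'I_(m.+1 * k.+1).
have cT : (0 < #|{: 'I_m.+1 * 'I_k.+1}|)%N by rewrite card_prod !card_ord.
pose E F := avg (fun t : 'I_m.+1 * 'I_k.+1 =>
   avg (fun v : {ffun 'I_(m.+1 * k.+1) -> bool} => F v t)) : R.
have w0 v t : 0 <= rect_energy Q a b v t.
  by rewrite rect_energy_sqr// sumr_ge0// => l _; exact: sqr_ge0.
have EW : E (rect_energy Q a b) = rho * \tr Q by exact: (avg_rect_energy Q am bk).
have EW_le : E (rect_energy Q a b) <= rho * n%:R by rewrite EW ler_wpM2l.
have sqE : E (fun v t => Num.sqrt (rect_energy Q a b v t)) <= Num.sqrt (rho * n%:R).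
  apply: (@le_trans _ _ (Num.sqrt (E (rect_energy Q a b)))); last first.
    by apply: ler_wsqrtr.
  have sq t : avg (fun v => Num.sqrt (rect_energy Q a b v t)) <=
      Num.sqrt (avg (fun v => rect_energy Q a b v t)).
    apply: le_trans (avg_le_sqrt _ cV) _; rewrite le_eqVlt; apply/orP; left.
    by apply/eqP; congr Num.sqrt; apply: eq_avg => v; rewrite sqr_sqrtr.
  apply: le_trans (ler_avg sq) _; apply: le_trans (avg_le_sqrt _ cT) _.
  rewrite le_eqVlt; apply/orP; left; apply/eqP.
  congr Num.sqrt; apply: eq_avg => t; rewrite sqr_sqrtr//.
  by rewrite -[leLHS](avg_cst cV); apply: ler_avg.
have Elin c1 c2 F : E (fun v t => c1 + c2 * F v t) = c1 + c2 * E F.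
  rewrite /E -[X in X + _](avg_cst cT) -avgZ -avgD; apply: eq_avg => t.
  by rewrite avgD avg_cst// avgZ.
have EE : a%:R * b%:R + -1 * E (rect_energy Q a b) <=
    D * al + D * be * E (fun v t => Num.sqrt (rect_energy Q a b v t)).
  rewrite -!Elin; apply: ler_avg => t; apply: ler_avg => v.
  by rewrite mulN1r; exact: h.
have Db0 : 0 <= D * be by rewrite !mulr_ge0 ?powR_ge0.
have := ler_wpM2l Db0 sqE; set S := Num.sqrt (rho * n%:R) => h1.
have mk0 : 0 < m.+1%:R * k.+1%:R :> R by rewrite mulr_gt0.
have nmk' : 2 * n%:R <= m.+1%:R * k.+1%:R :> R.
  by rewrite -!natrM ler_nat.
have : rho * n%:R <= a%:R * b%:R / 2.
  rewrite /rho -mulrA ler_wpM2l ?mulr_ge0// mulrC ler_pdivrMr//; lra.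
by lra.
Qed.

(** Sign patterns have norm at most a^(1/p) b^(1/t), so they are scaled into the ball before
    [rectangle_lower] is applied; the rest is bookkeeping of exponents. *)
Lemma lower_generic m k n a b (p t : \bar R) (L : {vspace 'M[R]_(m, k)}) (c : R) :
  (0 < a <= m)%N -> (0 < b <= k)%N -> (2 * n <= m * k)%N -> (\dim L <= n)%N ->
  (1 <= p)%E -> (1 <= t)%E -> 0 <= c ->
  (forall x, mnrm p t x <= 1 ->
     exists2 y, y \in L & mnrm q%:E sigma%:E (x - y) <= c) ->
  a%:R `^ (q^-1 - recip p) * b%:R `^ (sigma^-1 - recip t) / 2 <=
  c * (1 + n%:R `^ 2^-1 * m%:R `^ (- q^-1) * k%:R `^ (- sigma^-1) *
      a%:R `^ (q^-1 - 2^-1) * b%:R `^ (sigma^-1 - 2^-1)).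
Proof.
move=> am bk nmk dL p1 t1 c0 hc.
have [a0 b0] : (0 < a)%N /\ (0 < b)%N by move: am bk => /andP[? _] /andP[? _].
have [aR bR] : 0 < a%:R :> R /\ 0 < b%:R :> R by rewrite !ltr0n.
have [m0 k0] : (0 < m)%N /\ (0 < k)%N.
  by move: am bk => /andP[_ /(leq_trans a0) ?] /andP[_ /(leq_trans b0) ?].
have [mR kR] : 0 < m%:R :> R /\ 0 < k%:R :> R by rewrite !ltr0n.
pose l := a%:R `^ recip p * b%:R `^ recip t.
have l0 : 0 < l by rewrite mulr_gt0 ?powR_gt0.
have s1 : 1 <= sigma by move: hsigma => ?; lra.
have q1 : 1 <= q by move: hq => ?; lra.
have q1E : (1 <= q%:E)%E by rewrite lee_fin.
have s1E : (1 <= sigma%:E)%E by rewrite lee_fin.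
have hD (A : {set 'I_m}) (B : {set 'I_k}) x : #|A| = a -> #|B| = b ->
    is_pattern A B x -> exists2 y, y \in L & mnrm q%:E sigma%:E (x - y) <= l * c.
  move=> Aa Bb xAB.
  have [|y yL yc] := hc (l^-1 *: x).
    rewrite mixed_normZ// gtr0_norm ?invr_gt0// ler_pdivrMl// mulr1 /l -Aa -Bb.
    by apply: pattern_norm_le; rewrite ?Aa ?Bb.
  exists (l *: y); first exact: memvZ.
  rewrite (_ : x - l *: y = l *: (l^-1 *: x - y)).
    by rewrite mixed_normZ// gtr0_norm// ler_pM2l.
  by rewrite scalerBr scalerA divff ?scale1r// gt_eqF.
have := rectangle_lower am bk nmk dL (mulr_ge0 (ltW l0) c0) hD.
have pw (x u v w : R) : 0 < x -> u + v = w -> x `^ u * x `^ v = x `^ w.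
  by move=> x0 <-; rewrite powRD// (gt_eqF x0) implybT.
have -> : Num.sqrt (a%:R * b%:R / (m%:R * k%:R) * n%:R) =
    a%:R `^ 2^-1 * b%:R `^ 2^-1 * (m%:R `^ (- 2^-1) * k%:R `^ (- 2^-1)) * n%:R `^ 2^-1 :> R.
  have inv2 (x : R) : 0 < x -> x `^ (- 2^-1) = (x^-1) `^ 2^-1.
    by move=> x0; rewrite -[x^-1]powR_inv1 ?(ltW x0)// -powRrM mulN1r.
  rewrite (inv2 _ mR) (inv2 _ kR) -!powRM ?mulr_ge0 ?invr_ge0//.
  by rewrite powR12_sqrt ?mulr_ge0 ?invr_ge0// invfM.
set K := _ + _ => hK.
have P0 : 0 < a%:R `^ (1 - q^-1) * b%:R `^ (1 - sigma^-1) * l :> R.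
  by rewrite !mulr_gt0 ?powR_gt0.
rewrite -(ler_pM2l P0); apply: le_trans (le_trans _ hK) _;
  rewrite le_eqVlt; apply/orP; left; apply/eqP.
  rewrite /l; transitivity ((a%:R `^ (1 - q^-1) * a%:R `^ recip p * a%:R `^ (q^-1 - recip p)) *
   (b%:R `^ (1 - sigma^-1) * b%:R `^ recip t * b%:R `^ (sigma^-1 - recip t)) / 2 : R).
    by ring.
  rewrite (pw _ _ _ (1 - q^-1 + recip p))// (pw _ _ _ 1)//; last by ring.
  rewrite (pw _ _ _ (1 - sigma^-1 + recip t))// (pw _ _ _ 1)//; last by ring.
  by rewrite !powRr1.
rewrite /K mulrDr mulr1 mulrDr; congr (_ + _); first by ring.
rewrite -(pw m%:R (2^-1) (- q^-1) _ mR erefl) -(pw k%:R (2^-1) (- sigma^-1) _ kR erefl).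
rewrite -(pw a%:R (1 - q^-1 + (q^-1 - 2^-1)) 0 2^-1 aR); last by lra.
rewrite -(pw b%:R (1 - sigma^-1 + (sigma^-1 - 2^-1)) 0 2^-1 bR); last by lra.
rewrite !powRr0 !mulr1.
rewrite -(pw a%:R (1 - q^-1) (q^-1 - 2^-1) _ aR erefl).
rewrite -(pw b%:R (1 - sigma^-1) (sigma^-1 - 2^-1) _ bR erefl).
have mm : m%:R `^ 2^-1 * m%:R `^ (- 2^-1) = 1 :> R by rewrite (pw _ _ _ 0)// ?powRr0//; lra.
have kk : k%:R `^ 2^-1 * k%:R `^ (- 2^-1) = 1 :> R by rewrite (pw _ _ _ 0)// ?powRr0//; lra.
move: mm kk; clear.
move: (m%:R `^ 2^-1) (m%:R `^ (- 2^-1)) (k%:R `^ 2^-1) (k%:R `^ (- 2^-1)) => u1 u2 u3 u4 mm kk.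
move: (m%:R `^ _) (k%:R `^ _) (n%:R `^ _) => v1 v2 v7.
move: (a%:R `^ (1 - _)) (a%:R `^ (q^-1 - _)) => v3 v4.
move: (b%:R `^ (1 - _)) (b%:R `^ (sigma^-1 - _)) => v5 v6.
transitivity (l * c * (v1 * v2) * (v3 * v4 * (v5 * v6) * v7) * (u1 * u2) * (u3 * u4)).
  by ring.
by rewrite mm kk; ring.
Qed.

End LowerCases.

(** * Widths *)

Section Widths.
Context {R : realType} {V : vectType R}.
Variables (norm : V -> R) (M : set V) (n : nat) (D : R).

Lemma kolmogorov_width_le (L : {vspace V}) : (\dim L <= n)%N ->
  (forall x, M x -> exists2 y, y \in L & norm (x - y) <= D) ->
  (kolmogorov_width norm M n <= D%:E)%E.
Proof.
move=> dL h.
set S := ereal_sup [set ereal_inf [set (norm (x - y))%:E | y in [set` L]] | x in M].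
apply: (@le_trans _ _ S); first by apply: ereal_inf_lbound; exists L.
apply: ge_ereal_sup => _ [x Mx <-]; have [y yL yD] := h x Mx.
apply: le_trans (ereal_inf_lbound _) (_ : (norm (x - y))%:E <= _)%E.
  by exists y.
by rewrite lee_fin.
Qed.

(** If the width were below [D], some [L] would have all distances strictly below [D]; strictness
    supplies a point y even when the infimum over [L] is not known to be attained. *)
Lemma kolmogorov_width_ge :
  (forall L : {vspace V}, (\dim L <= n)%N ->
    ~ forall x, M x -> exists2 y, y \in L & norm (x - y) <= D) ->
  (D%:E <= kolmogorov_width norm M n)%E.
Proof.
move=> h; apply: le_ereal_inf_tmp => _ [L dL ->]; rewrite leNgt; apply/negP => lt.
apply: (h L dL) => x Mx.
have : (ereal_inf [set (norm (x - y))%:E | y in [set` L]] < D%:E)%E.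
  by apply: le_lt_trans lt; apply: ereal_sup_ubound; exists x.
move=> /ereal_inf_lt[_ [y yL <-]]; rewrite lte_fin => /ltW yD.
by exists y.
Qed.

End Widths.

(** * Matching lower bounds and assembly of the estimates *)

Section Cases.
Context {R : realType}.
Variables (q sigma : R).
Hypotheses (hq : 2 <= q) (hsigma : 2 <= sigma).

(** Rectangles with full columns, their number given by [support_choice]. The factor 8 is 2 from
    [lower_generic] times 4 from [support_choice]. *)
Lemma lower_case1 m k n (p : \bar R) (t : R) (L : {vspace 'M[R]_(m, k)}) (c M : R) :
  (0 < m)%N -> (0 < k)%N -> (2 * n <= m * k)%N -> (\dim L <= n)%N ->
  (q%:E <= p)%E -> 1 <= t -> t <= sigma -> 0 <= c ->
  M <= 1 -> ((0 < n)%N -> M <=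
    (n%:R `^ (- 2^-1) * m%:R `^ 2^-1 * k%:R `^ sigma^-1) `^ omega t%:E sigma) ->
  (forall x, mnrm p t%:E x <= 1 ->
     exists2 y, y \in L & mnrm q%:E sigma%:E (x - y) <= c) ->
  m%:R `^ (q^-1 - recip p) * M <= 8 * c.
Proof.
move=> m0 k0 nmk dL qp t1 ts c0 M1 Mn hc.
have [mR kR] : 0 < m%:R :> R /\ 0 < k%:R :> R by rewrite !ltr0n.
have q1 : 1 <= q by move: hq => ?; lra.
have t0 : t != 0 by rewrite gt_eqF//; lra.
(* The reciprocal of the base in the second term of the minimum; for n = 0 it is 0, which encodes
   the absence of that term. *)
pose rho : R := n%:R `^ 2^-1 * m%:R `^ (- 2^-1) * k%:R `^ (- sigma^-1).
have rho0 : 0 <= rho by rewrite !mulr_ge0 ?powR_ge0.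
have rho_le : rho <= k%:R `^ (2^-1 - sigma^-1).
  rewrite powRD ?(gt_eqF kR) ?implybT// ler_wpM2r ?powR_ge0//.
  rewrite powRN ler_pdivrMr ?powR_gt0// -powRM ?(ltW mR) ?(ltW kR)//.
  apply: ge0_ler_powR; rewrite ?nnegrE ?mulr_ge0 ?invr_ge0//.
  by rewrite -natrM ler_nat mulnC; apply: leq_trans nmk; rewrite leq_pmull.
have Mrho : 0 < rho -> M <= (rho^-1) `^ omega t%:E sigma.
  move=> rho_gt0; have n0 : (0 < n)%N.
    rewrite lt0n; apply/eqP => n0; move: rho_gt0.
    by rewrite /rho n0 powR0 ?invr_eq0 ?pnatr_eq0// !mul0r ltxx.
  by have := Mn n0; rewrite /rho !invfM !powRN !invrK.
have [s sk hs] := support_choice k0 hsigma t1 ts rho0 rho_le M1 Mrho.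
have p1 : (1 <= p)%E by apply: le_trans qp; rewrite lee_fin.
have t1E : (1 <= t%:E)%E by rewrite lee_fin.
have mm : (0 < m <= m)%N by rewrite m0 leqnn.
have := lower_generic hq hsigma mm sk nmk dL p1 t1E c0 hc.
rewrite recip_EFin//.
have -> : n%:R `^ 2^-1 * m%:R `^ (- q^-1) * k%:R `^ (- sigma^-1) * m%:R `^ (q^-1 - 2^-1) *
    s%:R `^ (sigma^-1 - 2^-1) = rho * s%:R `^ (sigma^-1 - 2^-1).
  congr (_ * _); rewrite /rho mulrAC; congr (_ * _); rewrite -mulrA; congr (_ * _).
  by rewrite -powRD ?(gt_eqF mR) ?implybT//; congr powR; ring.
set A := m%:R `^ (q^-1 - recip p).
have A0 : 0 <= A by exact: powR_ge0.
move: hs; set Y := 1 + _; set X := s%:R `^ _ => hs h.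
have Y0 : 0 < Y by rewrite ltr_wpDr// mulr_ge0 ?powR_ge0.
move: hs; rewrite ler_pdivlMr// => hs.
by rewrite -(ler_pM2r Y0); have := ler_wpM2l A0 hs; lra.
Qed.

(** The same argument with the two indices exchanged: all columns are used and the height of the
    rectangle is chosen. *)
Lemma lower_case2 m k n (p : R) (t : \bar R) (L : {vspace 'M[R]_(m, k)}) (c M : R) :
  (0 < m)%N -> (0 < k)%N -> (2 * n <= m * k)%N -> (\dim L <= n)%N ->
  1 <= p -> p <= q -> (sigma%:E <= t)%E -> 0 <= c ->
  M <= 1 -> ((0 < n)%N -> M <=
    (n%:R `^ (- 2^-1) * m%:R `^ q^-1 * k%:R `^ 2^-1) `^ omega p%:E q) ->
  (forall x, mnrm p%:E t x <= 1 ->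
     exists2 y, y \in L & mnrm q%:E sigma%:E (x - y) <= c) ->
  k%:R `^ (sigma^-1 - recip t) * M <= 8 * c.
Proof.
move=> m0 k0 nmk dL p1 pq st c0 M1 Mn hc.
have [mR kR] : 0 < m%:R :> R /\ 0 < k%:R :> R by rewrite !ltr0n.
have s1 : 1 <= sigma by move: hsigma => ?; lra.
have p0 : p != 0 by rewrite gt_eqF//; lra.
pose rho : R := n%:R `^ 2^-1 * m%:R `^ (- q^-1) * k%:R `^ (- 2^-1).
have rho0 : 0 <= rho by rewrite !mulr_ge0 ?powR_ge0.
have rho_le : rho <= m%:R `^ (2^-1 - q^-1).
  rewrite powRD ?(gt_eqF mR) ?implybT// /rho mulrAC ler_wpM2r ?powR_ge0//.
  rewrite powRN ler_pdivrMr ?powR_gt0// -powRM ?(ltW mR) ?(ltW kR)//.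
  apply: ge0_ler_powR; rewrite ?nnegrE ?mulr_ge0 ?invr_ge0//.
  by rewrite -natrM ler_nat; apply: leq_trans nmk; rewrite leq_pmull.
have Mrho : 0 < rho -> M <= (rho^-1) `^ omega p%:E q.
  move=> rho_gt0; have n0 : (0 < n)%N.
    rewrite lt0n; apply/eqP => n0; move: rho_gt0.
    by rewrite /rho n0 powR0 ?invr_eq0 ?pnatr_eq0// !mul0r ltxx.
  by have := Mn n0; rewrite /rho !invfM !powRN !invrK.
have [s sk hs] := support_choice m0 hq p1 pq rho0 rho_le M1 Mrho.
have t1 : (1 <= t)%E by apply: le_trans st; rewrite lee_fin.
have p1E : (1 <= p%:E)%E by rewrite lee_fin.
have kk : (0 < k <= k)%N by rewrite k0 leqnn.
have := lower_generic hq hsigma sk kk nmk dL p1E t1 c0 hc.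
rewrite recip_EFin//.
have -> : n%:R `^ 2^-1 * m%:R `^ (- q^-1) * k%:R `^ (- sigma^-1) * s%:R `^ (q^-1 - 2^-1) *
    k%:R `^ (sigma^-1 - 2^-1) = rho * s%:R `^ (q^-1 - 2^-1).
  rewrite mulrAC; congr (_ * _); rewrite /rho -[LHS]mulrA; congr (_ * _).
  by rewrite -powRD ?(gt_eqF kR) ?implybT//; congr powR; ring.
set A := k%:R `^ (sigma^-1 - recip t).
have A0 : 0 <= A by exact: powR_ge0.
move: hs; set Y := 1 + _; set X := s%:R `^ _ => hs h.
have Y0 : 0 < Y by rewrite ltr_wpDr// mulr_ge0 ?powR_ge0.
move: hs; rewrite ler_pdivlMr// => hs.
by rewrite -(ler_pM2r Y0); have := ler_wpM2l A0 hs; lra.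
Qed.

(* In the notation of Phi1 and Phi2, [A] is the factor in front of the minimum
   and [w] the power in its second term. *)
Lemma two_sided_bound m k n (p t : \bar R) (A w C Phi : R) :
  Phi = (if n == 0%N then A else Num.min A (A * w)) ->
  0 < A -> ((0 < n)%N -> 0 < w) -> 1 <= C ->
  (forall x : 'M[R]_(m, k), mnrm p t x <= 1 -> mnrm q%:E sigma%:E x <= A) ->
  ((0 < n)%N -> exists2 L : {vspace 'M[R]_(m, k)}, (\dim L <= n)%N &
    forall x, mnrm p t x <= 1 ->
    exists2 y, y \in L & mnrm q%:E sigma%:E (x - y) <= C * (A * w)) ->
  (forall (L : {vspace 'M[R]_(m, k)}) (c M : R), (\dim L <= n)%N -> 0 <= c ->
    M <= 1 -> ((0 < n)%N -> M <= w) ->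
    (forall x, mnrm p t x <= 1 ->
       exists2 y, y \in L & mnrm q%:E sigma%:E (x - y) <= c) ->
    A * M <= 8 * c) ->
  ((9^-1 * Phi)%:E <= kolmogorov_width (@mixed_norm R m k q%:E sigma%:E)
                        (@mixed_ball R m k p t) n <= (C * Phi)%:E)%E.
Proof.
move=> PhiE A0 w0 C1 hA hU hL.
have normE a b : @mixed_norm R m k a b = mnrm a b.
  by apply/funext => x; rewrite mnrmE.
have ballE x : mixed_ball p t x = (mnrm p t x <= 1) :> Prop.
  by rewrite /mixed_ball /= mnrmE.
rewrite normE; apply/andP; split.
  apply: kolmogorov_width_ge => L dL h.
  pose M := if n == 0%N then 1 else Num.min 1 w.
  have PhiM : Phi = A * M.
    by rewrite PhiE /M; case: ifP; rewrite ?mulr1// minr_pMr ?(ltW A0)// mulr1.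
  have M0 : 0 < M by rewrite /M; case: posnP => // /w0; rewrite lt_min ltr01.
  have Phi0 : 0 < Phi by rewrite PhiM mulr_gt0.
  (* Approximation within Phi/9 would give Phi <= 8 Phi/9, impossible for positive Phi; hence the
     constant 1/9. *)
  have : Phi <= 8 * (9^-1 * Phi); last by lra.
  rewrite {1}PhiM; apply: (hL L) => //.
  - by rewrite mulr_ge0 ?invr_ge0// ltW.
  - by rewrite /M; case: ifP => // _; rewrite ge_min lexx.
  - by rewrite lt0n /M => /negbTE ->; rewrite ge_min lexx orbT.
  - by move=> x x1; apply: h; rewrite ballE.
(* The zero subspace gives the first term of the minimum. *)
have wA : (kolmogorov_width (mnrm q%:E sigma%:E) (@mixed_ball R m k p t) n <= (C * A)%:E)%E.
  apply: (@kolmogorov_width_le _ _ _ _ _ _ 0%VS); first by rewrite dimv0.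
  move=> x; rewrite ballE => x1; exists 0; rewrite ?mem0v// subr0.
  by apply: le_trans (hA x x1) _; rewrite ler_peMl// ltW.
rewrite PhiE; case: posnP => // n0.
rewrite minr_pMr; last by apply: le_trans C1.
rewrite EFin_min le_min wA /=.
have [L dL h] := hU n0; apply: (kolmogorov_width_le dL) => x.
by rewrite ballE; exact: h.
Qed.

End Cases.

Theorem proposition2 (R : realType) (q sigma : R)
    (hq : 2 <= q) (hsigma : 2 <= sigma) :
  exists c C : R, [/\ 0 < c, c <= C &
    forall (m k n : nat) (p theta : \bar R),
      (0 < m)%N -> (0 < k)%N -> (2 * n <= m * k)%N ->
      (1 <= p)%E -> (1 <= theta)%E ->
      ((q%:E <= p)%E -> (theta <= sigma%:E)%E ->
        ((c * Phi1 q sigma m k n p theta)%:E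
           <= kolmogorov_width (@mixed_norm R m k q%:E sigma%:E)
                (@mixed_ball R m k p theta) n
           <= (C * Phi1 q sigma m k n p theta)%:E)%E) /\
      ((p <= q%:E)%E -> (sigma%:E <= theta)%E ->
        ((c * Phi2 q sigma m k n p theta)%:E
           <= kolmogorov_width (@mixed_norm R m k q%:E sigma%:E)
                (@mixed_ball R m k p theta) n
           <= (C * Phi2 q sigma m k n p theta)%:E)%E)].
Proof.
have [C1 C1_gt0 hC1] := upper_case1 hq hsigma.
have [C2 C2_gt0 hC2] := upper_case2 hq hsigma.
(* The summand 1 covers the bound by the zero subspace, [C1] and [C2] the two cases. *)
exists 9^-1, (1 + C1 + C2); split; [by rewrite invr_gt0|by lra|].
have [q1 s1] : 1 <= q /\ 1 <= sigma by split; lra.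
have C_ge1 : 1 <= 1 + C1 + C2 by lra.
move=> m k n p theta m0 k0 nmk p1 t1.
have [mR kR] : 0 < m%:R :> R /\ 0 < k%:R :> R by rewrite !ltr0n.
have nR : (0 < n)%N -> 0 < n%:R :> R by rewrite ltr0n.
have weaken (C D : R) (L : {vspace 'M[R]_(m, k)}) x : 0 <= D -> C <= 1 + C1 + C2 ->
    (exists2 y, y \in L & mnrm q%:E sigma%:E (x - y) <= C * D) ->
    exists2 y, y \in L & mnrm q%:E sigma%:E (x - y) <= (1 + C1 + C2) * D.
  by move=> D0 CC [y yL h]; exists y => //; apply: le_trans h _; rewrite ler_wpM2r.
split => [qp ts|pq st].
  have [t [thetaE t1' ts']] : exists t : R, [/\ theta = t%:E, 1 <= t & t <= sigma].
    by case: theta t1 ts => [t| |]//; rewrite !lee_fin => ? ?; exists t.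
  rewrite thetaE /Phi1.
  set A := m%:R `^ _; set u := n%:R `^ _ * _ * _.
  have u0 : (0 < n)%N -> 0 < u by move=> /nR n0; rewrite !mulr_gt0 ?powR_gt0.
  apply: (@two_sided_bound _ q sigma _ _ _ _ _ A (u `^ omega t%:E sigma)) => //.
  - exact: powR_gt0.
  - by move=> /u0 ?; exact: powR_gt0.
  - move=> x x1; apply: le_trans (lnorm_antimono _ t1' ts') _.
    apply: le_trans (mixed_norm_powmean_in _ q1 qp _) _; first by rewrite lee_fin.
    by rewrite ler_piMr ?powR_ge0.
  - move=> n0; have [L dL h] := hC1 m k n p t m0 k0 n0 qp t1' ts'.
    exists L => // x x1; apply: weaken (h x x1); last by lra.
    by rewrite mulr_ge0 ?powR_ge0.
  - move=> L c M dL c0 M1 Mw h.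
    exact: (lower_case1 hq hsigma m0 k0 nmk dL qp t1' ts' c0 M1 Mw h).
have [r [pE r1 rq]] : exists r : R, [/\ p = r%:E, 1 <= r & r <= q].
  by case: p p1 pq => [r| |]//; rewrite !lee_fin => ? ?; exists r.
rewrite pE /Phi2.
set A := k%:R `^ _; set u := n%:R `^ _ * _ * _.
have u0 : (0 < n)%N -> 0 < u by move=> /nR n0; rewrite !mulr_gt0 ?powR_gt0.
apply: (@two_sided_bound _ q sigma _ _ _ _ _ A (u `^ omega r%:E q)) => //.
- exact: powR_gt0.
- by move=> /u0 ?; exact: powR_gt0.
- move=> x x1; apply: le_trans (mixed_norm_antimono_in _ r1 rq _) _.
    by rewrite lee_fin.
  apply: le_trans (mixed_norm_powmean_out _ _ _ st) _; first exact: lt_le_trans s1.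
  by rewrite ler_piMr ?powR_ge0.
- move=> n0; have [L dL h] := hC2 m k n r theta m0 k0 n0 r1 rq st.
  exists L => // x x1; apply: weaken (h x x1); last by lra.
  by rewrite mulr_ge0 ?powR_ge0.
- move=> L c M dL c0 M1 Mw h.
  exact: (lower_case2 hq hsigma m0 k0 nmk dL r1 rq st c0 M1 Mw h).
Qed.
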